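(* Let $N\ge 1$ be an integer, $0<\theta\le 2$, $p=p_0:=1+\frac{\theta}{N}$, $0<\gamma<\min\{\theta,N\}$, and, if $0<\theta<2$, assume in addition $\gamma<\theta(p-1)$. Then there exists a constant $C_2>0$ depending only on $N,\theta,\gamma$ with the following property. Let $0<T<\infty$, let $\mu$ be a nonnegative Radon measure on $\mathbb{R}^N$, suppose that $u$ is a solution in $\mathbb{R}^N\times[0,T)$ (in the sense defined in the context) of $$\partial_t u+(-\Delta)^{\theta/2}u=|x|^{-\gamma}u^p,\quad x\in\mathbb{R}^N,\ t>0,\qquad u(0)=\mu\ \text{ in }\mathbb{R}^N,$$ and let $z\in\mathbb{R}^N$ satisfy $|z|>T^{1/\theta}$. Then $$\mu(B(z,\sigma))\le C_2\,|z|^{\frac{\gamma}{p-1}}\left[\log\left(e+\frac{T^{1/\theta}}{\sigma}\right)\right]^{-\frac{N}{\theta}}\qquad\text{for all }0<\sigma<T^{1/\theta}.$$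
   Context: $B(x,r)=\{y\in\mathbb{R}^N:|x-y|<r\}$. $(-\Delta)^{\theta/2}$ is the fractional power of $-\Delta$ in $\mathbb{R}^N$. $G=G(x,t)$ denotes the fundamental solution (heat kernel) of $\partial_t v+(-\Delta)^{\theta/2}v=0$ in $\mathbb{R}^N\times(0,\infty)$, i.e. $G(x,t)=(2\pi)^{-N}\int_{\mathbb{R}^N}e^{ix\cdot\xi-t|\xi|^\theta}\,d\xi$. Definition of solution: for $0<T\le\infty$, a nonnegative measurable function $u$ on $\mathbb{R}^N\times(0,T)$ is a solution of the Cauchy problem in $\mathbb{R}^N\times[0,T)$ if $$\infty>u(x,t)=\int_{\mathbb{R}^N}G(x-y,t)\,d\mu(y)+\int_0^t\int_{\mathbb{R}^N}G(x-y,t-s)|y|^{-\gamma}u(y,s)^p\,dy\,ds$$ for almost all $x\in\mathbb{R}^N$ and $0<t<T$. *)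

(* Defs.v *)
From HB Require Import structures.
From mathcomp Require Import all_boot all_order all_algebra.
From mathcomp Require Import complex.
From mathcomp Require Import all_classical all_reals all_analysis.
From mathcomp Require Import measurable_realfun lebesgue_Rintegral.

Set Implicit Arguments.
Unset Strict Implicit.
Unset Printing Implicit Defensive.
Import Order.TTheory GRing.Theory Num.Theory.
Import numFieldNormedType.Exports.

Local Open Scope classical_set_scope.
Local Open Scope ring_scope.

(* Matrices carry their Borel sigma-algebra; R^N is 'rV[R]_N. *)
HB.instance Definition _ (R : realType) (m n : nat) :=
  @isMeasurable.Build (sigma_display (@open 'M[R]_(m, n))) 'M[R]_(m, n)
    <<s @open 'M[R]_(m, n) >>
    (@sigma_algebra0 _ setT _) (@sigma_algebraC _ _)
    (@sigma_algebra_bigcup _ setT _).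

Section borel_rV.
Context {R : realType}.

Lemma open_measurable_rV (n : nat) (U : set 'rV[R]_n) : open U -> measurable U.
Proof. exact: sub_sigma_algebra. Qed.

Lemma measurable_coord_rV (n : nat) (i : 'I_n) :
  measurable_fun setT (fun v : 'rV[R]_n => v 0 i).
Proof.
apply: (measurability _ (RGenOpens.measurableE R)) => _ [_ [a [b ->]] <-].
rewrite setTI; apply: open_measurable_rV.
apply: open_comp; last exact: interval_open.
by move=> v _; exact: coord_continuous.
Qed.

Lemma open_rV_bigcup_rat_ball (n : nat) (U : set 'rV[R]_n) : open U ->
  U = \bigcup_(k in [set k : 'rV[rat]_n * rat |
        ball (map_mx ratr k.1 : 'rV[R]_n) (ratr k.2 : R) `<=` U])
      ball (map_mx ratr k.1 : 'rV[R]_n) (ratr k.2 : R).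
Proof.
move=> oU; apply/seteqP; split=> [v Uv|v [k]]; last exact.
have /nbhs_ballP[e /= e0 veU] : nbhs v U by exact: open_nbhs_nbhs.
have /rat_in_itvoo[r /[!in_itv]/= /andP[r0 re]] : 0 < e / 2 :> R.
  by rewrite divr_gt0.
have q_ex (i : 'I_n) : exists q : rat, ball (v 0 i) (ratr r) (ratr q : R).
  have /rat_in_itvoo[q /[!in_itv]/= /andP[vq qv]] : v 0 i < v 0 i + ratr r.
    by rewrite ltrDl.
  by exists q; rewrite /ball/= ltr_distlC (lt_le_trans _ (ltW vq)) ?ltrBlDr ?ltrDl.
have [q qP] := choice q_ex.
have bq : ball (map_mx ratr (\row_i q i) : 'rV[R]_n) (ratr r) v.
  by split=> // i j; rewrite !mxE ord1; apply/ball_sym; exact: qP.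
exists (\row_i q i, r) => //= w bw; apply: veU.
rewrite (splitr e); apply: ball_triangle (le_ball (ltW re) bw).
by apply/ball_sym; exact: (le_ball (ltW re) bq).
Qed.

Lemma measurable_fun_rV d (T : measurableType d) (n : nat)
    (f : T -> 'rV[R]_n) :
  (forall i, measurable_fun setT (fun t => f t 0 i)) -> measurable_fun setT f.
Proof.
move=> mf; apply: (measurability (@open 'rV[R]_n)) => // _ [U oU <-].
rewrite setTI (open_rV_bigcup_rat_ball oU) preimage_bigcup bigcup_mkcond.
apply: countable_bigcupT_measurable => // k; case: ifP => // _.
case: (ltP (0 : R) (ratr k.2)) => k0; last first.
  rewrite [X in measurable X](_ : _ = set0)// -subset0 => t [/=].
  by rewrite ltNge k0.
rewrite [X in measurable X](_ : _ = \bigcap_(i in [set: 'I_n])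
    (fun t => f t 0 i) @^-1` ball (ratr (k.1 0 i) : R) (ratr k.2)).
  apply: fin_bigcap_measurable => // i _; rewrite -[X in measurable X]setTI.
  by apply: mf => //; exact: measurable_ball.
apply/seteqP; split=> [t [_ bt] i _|t bt].
  by have := bt 0 i; rewrite mxE.
by split=> // j i; rewrite ord1 mxE; exact: bt.
Qed.

Definition cons_rV (n : nat) (p : measurableTypeR R * 'rV[R]_n) : 'rV[R]_n.+1 :=
  row_mx (p.1%:M : 'rV_1) p.2.

Definition uncons_rV (n : nat) (v : 'rV[R]_n.+1) : measurableTypeR R * 'rV[R]_n :=
  (v 0 0, rsubmx (v : 'rV_(1 + n))).

Lemma cons_rVK (n : nat) : cancel (@cons_rV n) (@uncons_rV n).
Proof.
case=> a v; rewrite /uncons_rV/cons_rV/= row_mxKr; congr pair.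
transitivity (row_mx (a%:M : 'rV_1) v 0 (lshift n 0)).
  by congr (row_mx _ _ _ _); exact: val_inj.
by apply: etrans (row_mxEl _ _ _ _) _; rewrite mxE.
Qed.

Lemma measurable_cons_rV (n : nat) : measurable_fun setT (@cons_rV n).
Proof.
apply: measurable_fun_rV => i.
case: (split_ordP (i : 'I_(1 + n))) => j ->.
  rewrite (_ : (fun _ => _) = (@fst R 'rV[R]_n)); first exact: measurable_fst.
  by apply/funext => p; apply: etrans (row_mxEl _ _ _ _) _; rewrite mxE !ord1.
rewrite (_ : (fun _ => _) = (fun v => v 0 j) \o (@snd R 'rV[R]_n)).
  exact: measurableT_comp (measurable_coord_rV j) measurable_snd.
by apply/funext => p; exact: row_mxEr.
Qed.

Lemma measurable_uncons_rV (n : nat) : measurable_fun setT (@uncons_rV n).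
Proof.
apply: measurable_fun_pair; first exact: measurable_coord_rV.
apply: measurable_fun_rV => i.
rewrite (_ : (fun _ => _) = fun v : 'rV[R]_n.+1 => v 0 (rshift 1 i)).
  exact: measurable_coord_rV.
by apply/funext => v; rewrite mxE.
Qed.

Lemma uncons_rVK (n : nat) : cancel (@uncons_rV n) (@cons_rV n).
Proof.
move=> v; rewrite /cons_rV/uncons_rV/= -[RHS](hsubmxK (v : 'rV_(1 + n))).
apply: (congr1 (fun w : 'rV_1 => row_mx w _)).
apply/rowP => i; rewrite !mxE !ord1 eqxx mulr1n.
by congr (v _ _); exact: val_inj.
Qed.

End borel_rV.

Section lebesgue_rV.
Context {R : realType}.
Local Open Scope ereal_scope.

Section step.
Context (n : nat) (m : {sigma_finite_measure set 'rV[R]_n -> \bar R}).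

Definition lebesgue_rVS : set 'rV[R]_n.+1 -> \bar R :=
  pushforward (@lebesgue_measure R \x m) (@cons_rV R n).

Let mpush := measure_function_pushforward__canonical__measure_function_Measure
  (@lebesgue_measure R \x m) (@measurable_cons_rV R n).

Let lebesgue_rVS0 : lebesgue_rVS set0 = 0.
Proof. exact: (measure0 mpush). Qed.

Let lebesgue_rVS_ge0 A : 0 <= lebesgue_rVS A.
Proof. exact: (measure_ge0 mpush). Qed.

Let lebesgue_rVS_sigma_additive : semi_sigma_additive lebesgue_rVS.
Proof. exact: (@measure_semi_sigma_additive _ _ _ mpush). Qed.

HB.instance Definition _ := isMeasure.Build _ _ _ lebesgue_rVS
  lebesgue_rVS0 lebesgue_rVS_ge0 lebesgue_rVS_sigma_additive.

Let lebesgue_rVS_sigma_finite : sigma_finite setT lebesgue_rVS.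
Proof.
have [F FT Foo] : sigma_finite setT (@lebesgue_measure R \x m).
  have /sigma_finiteP[F [TF ndF Foo]] := sigma_finiteT (@lebesgue_measure R).
  have /sigma_finiteP[G [TG ndG Goo]] := sigma_finiteT m.
  exists (fun n => F n `*` G n).
    rewrite -setXTT TF TG predeqE => -[x y]; split.
      move=> [/= [i _ Fix] [j _ Gjy]]; exists (maxn i j) => //; split.
      - by move: x Fix; exact/subsetPset/ndF/leq_maxl.
      - by move: y Gjy; exact/subsetPset/ndG/leq_maxr.
    by move=> [i _ []/= ? ?]; split; exists i.
  move=> k; have [? ?] := Foo k; have [? ?] := Goo k.
  split; first exact: measurableX.
  by rewrite product_measure1E// lte_mul_pinfty// ge0_fin_numE.
exists (fun k => @uncons_rV R n @^-1` F k).
  by rewrite -preimage_bigcup -FT preimage_setT.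
move=> k; have [mF Fk] := Foo k; split.
  by rewrite -[X in measurable X]setTI; exact: measurable_uncons_rV.
rewrite /lebesgue_rVS /pushforward -comp_preimage.
by rewrite (_ : _ \o _ = id)//; apply/funext; exact: cons_rVK.
Qed.

HB.instance Definition _ := Measure_isSigmaFinite.Build _ _ _ lebesgue_rVS
  lebesgue_rVS_sigma_finite.
End step.

(* R^n.+1 is measured as R x R^n; see lebesgue_rV_box for the normalization. *)
Fixpoint lebesgue_rV (n : nat) :
    {sigma_finite_measure set 'rV[R]_n -> \bar R} :=
  if n is n'.+1 then lebesgue_rVS (lebesgue_rV n') else \d_(0%R : 'rV[R]_0).

Lemma lebesgue_rV_box n (a b : 'rV[R]_n) : (forall i, (a 0 i <= b 0 i)%R) ->
  lebesgue_rV n [set v | forall i, (a 0 i <= v 0 i <= b 0 i)%R] =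
  (\prod_(i < n) (b 0 i - a 0 i))%:E.
Proof.
elim: n a b => [|n ih] a b ab.
  by rewrite big_ord0 /= diracE mem_set//= => -[].
pose a' : 'rV[R]_n := \row_i a 0%R (lift ord0 i).
pose b' : 'rV[R]_n := \row_i b 0%R (lift ord0 i).
have ab' i : (a' 0 i <= b' 0 i)%R by rewrite !mxE.
rewrite [LHS]/= /lebesgue_rVS /pushforward.
have consE (p : measurableTypeR R * 'rV[R]_n) :
    cons_rV p 0%R 0%R = p.1 /\ (forall i, cons_rV p 0%R (lift ord0 i) = p.2 0%R i).
  split=> [|i].
    transitivity (row_mx (p.1%:M : 'rV_1) p.2 0%R (lshift n 0%R)).
      by congr (row_mx _ _ _ _); exact: val_inj.
    by apply: etrans (row_mxEl _ _ _ _) _; rewrite mxE.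
  transitivity (row_mx (p.1%:M : 'rV_1) p.2 0%R (rshift 1 i)).
    by congr (row_mx _ _ _ _); exact: val_inj.
  exact: row_mxEr.
rewrite (_ : _ @^-1` _ = `[a 0%R 0%R, b 0%R 0%R] `*`
    [set v : 'rV[R]_n | forall i, (a' 0 i <= v 0 i <= b' 0 i)%R]); last first.
  apply/seteqP; split=> p /=; have [p0 pS] := consE p.
    move=> h; split; first by rewrite in_itv/= -p0.
    by move=> i; rewrite !mxE -pS.
  rewrite in_itv/= => -[h0 hS] i.
  have [j ->|->] := unliftP ord0 i.
    by rewrite pS; have := hS j; rewrite !mxE.
  by rewrite [cons_rV p 0%R _]p0.
rewrite product_measure1E//; last first.
  rewrite [X in measurable X](_ : _ = \bigcap_(i in [set: 'I_n])
      (fun v : 'rV[R]_n => v 0%R i) @^-1` `[a' 0%R i, b' 0%R i]).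
    apply: fin_bigcap_measurable => // i _; rewrite -[X in measurable X]setTI.
    exact: measurable_coord_rV.
  apply/seteqP; split=> v h i /=; first by move=> _; rewrite in_itv/=; exact: h.
  by have := h i I; rewrite /= in_itv.
rewrite ih// big_ord_recl EFinM; congr (_ * _).
  apply: etrans (lebesgue_measure_itv _) _; rewrite /= lte_fin -EFinB.
  by case: ltgtP (ab 0%R) => // -> _; rewrite subrr.
by congr EFin; apply: eq_bigr => i _; rewrite !mxE.
Qed.

End lebesgue_rV.

Section euclidean.
Context {R : realType} {N : nat}.
Implicit Types x y : 'rV[R]_N.

Definition dotv x y : R := \sum_(i < N) x 0 i * y 0 i.

(* the norm `|x| of the library on 'rV[R]_N is the sup norm *)
Definition enorm x : R := Num.sqrt (\sum_(i < N) x 0 i ^+ 2).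

Definition eball x (r : R) : set 'rV[R]_N := [set y | enorm (x - y) < r].

End euclidean.

Section complex_integral.
Context {R : realType}.
Local Open Scope complex_scope.

Definition cexp (z : R[i]) : R[i] :=
  (expR (complex.Re z) * cos (complex.Im z)) +i*
  (expR (complex.Re z) * sin (complex.Im z)).

Definition cintegral d (T : measurableType d) (mu : {measure set T -> \bar R})
    (f : T -> R[i]) : R[i] :=
  Rintegral mu setT (fun x => complex.Re (f x)) +i*
  Rintegral mu setT (fun x => complex.Im (f x)).

End complex_integral.

Section heat_equation.
Context {R : realType} {N : nat}.

Section kernel.
Local Open Scope complex_scope.

Definition heat_kernelC (theta : R) (x : 'rV[R]_N) (t : R) : R[i] :=
  ((2 * pi) ^- N)%:C *
  cintegral (lebesgue_rV N) (fun xi : 'rV[R]_N =>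
    cexp ('i * (dotv x xi)%:C - (t * enorm xi `^ theta)%:C)).

(* heat_kernelC is real-valued: its imaginary part is the integral of an odd
   function of xi. *)
Definition heat_kernel (theta : R) (x : 'rV[R]_N) (t : R) : R :=
  complex.Re (heat_kernelC theta x t).

End kernel.

(* On R^N, a Radon measure is a Borel measure that is finite on compact sets. *)
Definition radon (mu : {measure set 'rV[R]_N -> \bar R}) : Prop :=
  forall K : set 'rV[R]_N, compact K -> (mu K < +oo)%E.

Definition time_interval (T : \bar R) : set R :=
  [set t | 0 < t /\ (t%:E < T)%E].

Definition lebesgue_space_time :
    {measure set ('rV[R]_N * measurableTypeR R) -> \bar R} :=
  (lebesgue_rV N \x @lebesgue_measure R)%E.

(* Measurability is Lebesgue measurability, hence the completed
   sigma-algebra: {mfun _ >-> _} would only allow Borel functions. *)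
Definition lebesgue_measurable_fun (D : set ('rV[R]_N * measurableTypeR R))
    (f : 'rV[R]_N * measurableTypeR R -> \bar R) : Prop :=
  forall Y : set (\bar R), measurable Y ->
    completed_algebra_gen lebesgue_space_time (D `&` f @^-1` Y).

Section solution.
Local Open Scope ereal_scope.
Variables (theta gamma p : R) (mu : {measure set 'rV[R]_N -> \bar R}).
Variable u : 'rV[R]_N -> R -> \bar R.

(* enorm 0 `^ (- gamma) is 0 rather than +oo; the origin is a null set. *)
Definition duhamel (x : 'rV[R]_N) (t : R) : \bar R :=
  \int[mu]_y (heat_kernel theta (x - y)%R t)%:E +
  \int[lebesgue_measure]_(s in `]0%R, t[) \int[lebesgue_rV N]_y
    ((heat_kernel theta (x - y)%R (t - s)%R)%:E
      * (enorm y `^ (- gamma))%R%:E * u y s `^ p).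

(* "for almost all x and 0 < t < T" is read as almost everywhere in space-time;
   values of u outside R^N x (0, T) are irrelevant. *)
Definition is_solution (T : \bar R) : Prop :=
  [/\ lebesgue_measurable_fun (setT `*` time_interval T)
        (fun xt => u xt.1 xt.2),
      forall x t, time_interval T t -> 0 <= u x t &
      {ae lebesgue_space_time, forall xt, time_interval T xt.2 ->
        u xt.1 xt.2 < +oo /\ u xt.1 xt.2 = duhamel xt.1 xt.2}].

End solution.
End heat_equation.

(* Main.v *)
(** Positivity of the heat kernel. Functions that are bounded limits of positive
    combinations of x |-> cos (a . x) have nonnegative integral against
    triangular weights, and they are stable under products and exponentials.
    Gaussians are in this class, and so is exp (- t |x|^theta): with
    al = theta / 2, the function 1 - (1 - f)^al is a power series in f with
    nonnegative coefficients, and n^al (1 - exp (- |x|^2 / n))^al tends to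
    |x|^theta. Together with cos v >= 1 - v^2 / 2 this gives
    G (x, t) >= c t^(-N/theta) for |x| <= kappa t^(1/theta).

    The estimate. Put tau_j = 4^j tau_0 and let Q_j be the cube around w of
    radius eps tau_j^(1/theta), where Q_0 carries the mass m of mu. Duhamel's
    formula gives u >= b_j tau_j^(-N/theta) on Q_j x (tau_j, 2 tau_j) with
    b_0 = c' m and b_(j+1) = b_j + C |z|^(-gamma) b_j^p: the critical exponent
    makes every earlier block contribute at the same order. Iterating Duhamel's
    formula inside one block shows that b_j^(p-1) <= C |z|^gamma, as otherwise
    u = +oo there. The recursion then yields b_0^(p-1) <= C |z|^gamma / (J + 1)
    with J of the order of log (T^(1/theta) / sigma). *)

Require Import Defs.
From HB Require Import structures.
From mathcomp Require Import all_boot all_order all_algebra.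
From mathcomp Require Import complex.
From mathcomp Require Import all_classical all_reals all_analysis.
From mathcomp Require Import measurable_realfun lebesgue_Rintegral ring lra.

Set Implicit Arguments.
Unset Strict Implicit.
Unset Printing Implicit Defensive.
Import Order.TTheory GRing.Theory Num.Theory.
Import numFieldNormedType.Exports.

Local Open Scope classical_set_scope.
Local Open Scope ring_scope.

(** * Positivity of the heat kernel *)

(** Besides positivity, the kernel is bounded below only at its own scale |x| <= kappa t^(1/theta),
    so each use of Duhamel's formula has to compare cubes and elapsed times of the same parabolic
    size. The critical exponent enters through n (p - 1) = theta: a block of height b A^(-n), width
    A and duration A^theta produces a mass of order b^p A^(-np) A^n A^theta = b^p, whatever A is.
    The condition |z| > T^(1/theta) keeps all cubes within a distance of order |z| from the origin,
    where |y|^(-gamma) is at least a multiple of |z|^(-gamma). As u is controlled only up to null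
    sets, all bounds on it hold almost everywhere, and they are turned into lower bounds of
    integrals by step functions below the integrand. *)

Section integral_rV.
Context {R : realType}.
Local Open Scope ereal_scope.

Lemma ge0_integral_rVS n (f : 'rV[R]_n.+1 -> \bar R) :
  measurable_fun setT f -> (forall v, 0 <= f v) ->
  \int[lebesgue_rV n.+1]_v f v =
  \int[@lebesgue_measure R]_a \int[lebesgue_rV n]_v f (cons_rV (a, v)).
Proof.
move=> mf f0.
have mc := @measurable_cons_rV R n.
have mfc : measurable_fun setT (f \o @cons_rV R n) by exact: measurable_comp mf mc.
rewrite -(fubini_tonelli1 (m1 := lebesgue_measure) (m2 := lebesgue_rV n)
  (f \o @cons_rV R n))//; last by move=> x; exact: f0.
by rewrite (@ge0_integral_pushforward _ _ _ _ _ _ mc _ setT f).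
Qed.

Lemma integral_rVS n (f : 'rV[R]_n.+1 -> \bar R) :
  (lebesgue_rV n.+1).-integrable setT f ->
  \int[lebesgue_rV n.+1]_v f v =
  \int[@lebesgue_measure R]_a \int[lebesgue_rV n]_v f (cons_rV (a, v)).
Proof.
move=> fi.
have mf := measurable_int _ fi.
have mc := @measurable_cons_rV R n.
have mfc : measurable_fun setT (f \o @cons_rV R n) by exact: measurable_comp mf mc.
have ic : (@lebesgue_measure R \x lebesgue_rV n).-integrable setT (f \o @cons_rV R n).
  apply/integrableP; split => //.
  have /integrableP[_] := fi.
  rewrite [X in X < _ -> _](@ge0_integral_pushforward _ _ _ _ _ _ mc _ setT (fun v => `|f v|))//.
  exact: measurableT_comp.
transitivity (\int[@lebesgue_measure R \x lebesgue_rV n]_z (f \o @cons_rV R n) z).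
  by rewrite [LHS](@integral_pushforward _ _ _ _ _ _ mc _ setT f).
by rewrite -(integral12_prod_meas1 ic).
Qed.

Lemma cons_rV0 n a (v : 'rV[R]_n) : cons_rV (a, v) 0%R 0%R = a.
Proof.
have -> : (0%R : 'I_n.+1) = lshift n (0%R : 'I_1) by exact: val_inj.
by apply: etrans (row_mxEl _ _ _ _) _; rewrite mxE.
Qed.

Lemma cons_rVS n a (v : 'rV[R]_n) i : cons_rV (a, v) 0%R (lift ord0 i) = v 0%R i.
Proof.
have -> : lift ord0 i = rshift 1 i by exact: val_inj.
exact: row_mxEr.
Qed.

Lemma measurable_prod_rV n (w : R -> R) : measurable_fun setT w ->
  measurable_fun setT (fun v : 'rV[R]_n => (\prod_(i < n) w (v 0 i))%R).
Proof.
move=> mw; apply: measurable_prod => i _.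
exact: (measurable_comp _ _ mw (measurable_coord_rV i)).
Qed.

Lemma ge0_integral_prod_rV n (w : R -> R) (W : R) : measurable_fun setT w ->
  (forall s, 0 <= w s)%R -> \int[@lebesgue_measure R]_s (w s)%:E = W%:E ->
  \int[lebesgue_rV n]_v (\prod_(i < n) w (v 0 i))%:E = (W ^+ n)%:E.
Proof.
move=> mw w0 wW; elim: n => [|n ih].
  under eq_integral do rewrite big_ord0.
  by rewrite integral_cst//= diracT mule1 expr0.
rewrite ge0_integral_rVS; last 2 first.
  by apply/measurable_EFinP; exact: measurable_prod_rV.
  by move=> v; rewrite lee_fin; apply: prodr_ge0.
transitivity (\int[lebesgue_measure]_a ((W ^+ n)%:E * (w a)%:E)).
  apply: eq_integral => a _.
  under eq_integral => v _.
    rewrite big_ord_recl cons_rV0.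
    under eq_bigr do rewrite cons_rVS.
    rewrite EFinM; over.
  rewrite ge0_integralZl//; last 3 first.
    by apply/measurable_EFinP; exact: measurable_prod_rV.
    by move=> v _; rewrite lee_fin; apply: prodr_ge0.
    by rewrite lee_fin.
  by rewrite ih muleC.
have Wn0 : (0 <= W ^+ n)%R.
  rewrite exprn_ge0// -lee_fin -wW integral_ge0// => x _.
  by rewrite lee_fin.
rewrite ge0_integralZl//; last 2 first.
  exact/measurable_EFinP.
  by move=> v _; rewrite lee_fin.
by rewrite wW -EFinM exprSr.
Qed.

Lemma measurable_dotv n (b : 'rV[R]_n) : measurable_fun setT (dotv b).
Proof.
apply: measurable_sum => i; apply: measurable_funM => //.
exact: measurable_coord_rV.
Qed.

Lemma measurable_cos : measurable_fun setT (@cos R).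
Proof. exact: continuous_measurable_fun (@continuous_cos R). Qed.

Lemma integrable_prod_rV n (w : R -> R) (W : R) : measurable_fun setT w ->
  (forall s, 0 <= w s)%R -> \int[@lebesgue_measure R]_s (w s)%:E = W%:E ->
  (lebesgue_rV n).-integrable setT (fun v => (\prod_(i < n) w (v 0%R i))%:E).
Proof.
move=> mw w0 wW; apply/integrableP; split.
  by apply/measurable_EFinP; exact: measurable_prod_rV.
under eq_integral.
  move=> v _; rewrite gee0_abs; last by rewrite lee_fin; apply: prodr_ge0.
  over.
by rewrite (ge0_integral_prod_rV _ mw w0 wW) ltry.
Qed.

(** The phase [c] makes the induction on [n] work: for the integral over the last coordinates, the
    term of the first one is a mere phase. *)
Lemma integral_cos_prod_rV n (w : R -> R) (W : R) (J : R -> R) (c : R) (b : 'rV[R]_n) :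
  measurable_fun setT w ->
  (forall s, 0 <= w s)%R -> \int[@lebesgue_measure R]_s (w s)%:E = W%:E ->
  (forall c b, \int[@lebesgue_measure R]_s (cos (c + b * s) * w s)%:E = (cos c * J b)%:E) ->
  \int[lebesgue_rV n]_v (cos (c + dotv b v) * \prod_(i < n) w (v 0 i))%:E =
  (cos c * \prod_(i < n) J (b 0 i))%:E.
Proof.
move=> mw w0 wW wJ.
have intn m c' (d : 'rV[R]_m) : (lebesgue_rV m).-integrable setT
    (fun v => (cos (c' + dotv d v) * \prod_(i < m) w (v 0%R i))%:E).
  apply: (le_integrable measurableT _ _ (integrable_prod_rV m mw w0 wW)).
  - apply/measurable_EFinP/measurable_funM; last exact: measurable_prod_rV.
    apply: (measurable_comp _ _ measurable_cos) => //.
    by apply: measurable_funD => //; exact: measurable_dotv.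
  - by move=> v _; rewrite !lee_fin normrM ler_piMl// ?cos_max.
elim: n c b => [|n ih] c b.
  under eq_integral do rewrite /dotv !big_ord0 addr0.
  by rewrite integral_cst//= diracT mule1 big_ord0.
rewrite integral_rVS//.
pose b' : 'rV[R]_n := \row_i b 0%R (lift ord0 i).
have dE a (v : 'rV[R]_n) : dotv b (cons_rV (a, v)) = (b 0%R 0%R * a + dotv b' v)%R.
  rewrite /dotv big_ord_recl cons_rV0; congr (_ + _)%R.
  by apply: eq_bigr => i _; rewrite cons_rVS mxE.
transitivity (\int[lebesgue_measure]_a
    ((\prod_(i < n) J (b' 0 i))%:E * (cos (c + b 0 0 * a) * w a)%:E)).
  apply: eq_integral => a _.
  under eq_integral => v _.
    rewrite big_ord_recl cons_rV0.
    under eq_bigr do rewrite cons_rVS.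
    rewrite dE addrA mulrCA EFinM; over.
  by rewrite integralZl// ih -!EFinM; congr (_ %:E); rewrite mulrCA mulrA mulrC.
rewrite integralZl//.
  rewrite wJ -EFinM big_ord_recl mulrC mulrA; congr (_ * _)%:E.
  by apply: eq_bigr => i _; rewrite mxE.
have wi : (@lebesgue_measure R).-integrable setT (fun s => (w s)%:E).
  apply/integrableP; split; first exact/measurable_EFinP.
  by under eq_integral do rewrite gee0_abs ?lee_fin//; rewrite wW ltry.
apply: (le_integrable measurableT _ _ wi).
- apply/measurable_EFinP/measurable_funM => //.
  apply: (measurable_comp _ _ measurable_cos) => //.
  exact: measurable_funD.
- by move=> v _; rewrite !lee_fin normrM ler_piMl// ?cos_max.
Qed.

End integral_rV.

(** * Triangular weights and their cosine transforms *)

Section triangle_weight.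
Context {R : realType}.
Local Notation leb := (@lebesgue_measure R).

Lemma integral_antiderivative (f F : R -> R) a b : a < b -> continuous f ->
  (forall x : R, is_derive x 1 F (f x)) ->
  (\int[leb]_(x in `[a, b]) (f x)%:E = (F b - F a)%:E)%E.
Proof.
move=> ab cf dF.
have cF : continuous F.
  move=> x; apply/differentiable_continuous/derivable1_diffP.
  by have := dF x => -[].
rewrite (@continuous_FTC2 _ f F)//.
- exact: continuous_subspaceT.
- split.
  + by move=> x _; have := dF x => -[].
  + exact/cvg_at_right_filter/cF.
  + exact/cvg_at_left_filter/cF.
- by move=> x _; rewrite derive1E; apply: derive_val.
Qed.

(** A weight of bounded support whose cosine transform is nonnegative: it cuts off an integral
    without spoiling the sign for cosines. *)
Definition tri (h s : R) : R := Num.max 0 (1 - `|s| / h).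

Lemma tri_ge0 h s : 0 <= tri h s.
Proof. by rewrite /tri le_max lexx. Qed.

Lemma tri_le1 h s : 0 < h -> tri h s <= 1.
Proof. by move=> h0; rewrite /tri ge_max ler01 gerBl divr_ge0// ltW. Qed.

Lemma measurable_tri h : measurable_fun setT (tri h).
Proof.
apply: measurable_maxr => //; apply: measurable_funB => //.
by apply: measurable_funM => //; exact: normr_measurable.
Qed.

(** The weight has a kink at 0, so the integral is split there and each half has its own
    antiderivative. *)
Lemma integral_tri (f Fl Fr : R -> R) (h : R) : 0 < h -> continuous f ->
  (forall x : R, is_derive x 1 Fl (f x * (1 + x / h))) ->
  (forall x : R, is_derive x 1 Fr (f x * (1 - x / h))) ->
  (\int[leb]_s (f s * tri h s)%:E = (Fl 0 - Fl (- h) + (Fr h - Fr 0))%:E)%E.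
Proof.
move=> h0 cf dl dr.
have mf : measurable_fun setT (fun s => (f s * tri h s)%:E).
  apply/measurable_EFinP/measurable_funM; last exact: measurable_tri.
  exact: continuous_measurable_fun.
have sub : (\int[leb]_s (f s * tri h s)%:E =
    \int[leb]_(s in `[(- h)%R, h]) (f s * tri h s)%:E)%E.
  rewrite [RHS]integral_mkcond; apply: eq_integral => s _.
  rewrite patchE; case: ifPn => //; rewrite notin_setE/= in_itv/= => /negP hs.
  rewrite /tri max_l ?mulr0// subr_le0 ler_pdivlMr// mul1r leNgt.
  by apply: contra hs => /ltW; rewrite ler_norml.
have hU : ([set` `[- h, h]] : set R) = `[- h, 0[ `|` `[0, h].
  apply/seteqP; split=> s /=; rewrite !in_itv/=.
    by move=> /andP[-> ->]; rewrite andbT /=; case: ltP => _; [left|right].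
  move=> [/andP[-> /ltW s0]|/andP[s0 ->]] /=.
    by rewrite (le_trans s0)// ltW.
  by rewrite andbT (le_trans _ s0)// oppr_le0 ltW.
rewrite sub hU integral_setU//=; last 2 first.
- exact: measurable_funTS.
- apply/disj_setPS => s /= []; rewrite !in_itv/= => /andP[_ s0] /andP[s1 _].
  by move: s0; rewrite ltNge s1.
rewrite integral_itv_bndo_bndc; last exact: measurable_funTS.
have cl : continuous (fun s => f s * (1 + s / h)).
  move=> s; apply: cvgM; first exact: cf.
  by apply: cvgD; [exact: cvg_cst|apply: cvgM; [exact: cvg_id|exact: cvg_cst]].
have cr : continuous (fun s => f s * (1 - s / h)).
  move=> s; apply: cvgM; first exact: cf.
  by apply: cvgB; [exact: cvg_cst|apply: cvgM; [exact: cvg_id|exact: cvg_cst]].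
rewrite EFinD -(integral_antiderivative _ cl dl) ?oppr_lt0//.
rewrite -(integral_antiderivative h0 cr dr).
congr (_ + _)%E; apply: eq_integral => s; rewrite inE/= in_itv/= => /andP[s1 s2].
- rewrite /tri ler0_norm// mulNr opprK max_r//.
  by rewrite -lerBlDl sub0r ler_pdivlMr// mulN1r.
- by rewrite /tri ger0_norm// max_r// subr_ge0 ler_pdivrMr// mul1r.
Qed.

(** The Fejer kernel; the value [h] at 0 is the limit of the other branch. *)
Definition tri_fourier (h b : R) : R :=
  if b == 0 then h else 2 * (1 - cos (b * h)) / (h * b ^+ 2).

Lemma tri_fourier_ge0 h b : 0 < h -> 0 <= tri_fourier h b.
Proof.
move=> h0; rewrite /tri_fourier; case: ifP => _; first exact: ltW.
by apply: divr_ge0; apply: mulr_ge0; rewrite ?subr_ge0 ?cos_le1 ?sqr_ge0 ?(ltW h0).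
Qed.

Lemma integral_cos_tri h c b : 0 < h ->
  (\int[leb]_s (cos (c + b * s) * tri h s)%:E = (cos c * tri_fourier h b)%:E)%E.
Proof.
move=> h0; have hN0 := lt0r_neq0 h0.
have cc : continuous (fun s => cos (c + b * s)).
  move=> x; apply: continuous_comp; last exact: continuous_cos.
  by apply: cvgD; [exact: cvg_cst|apply: cvgM; [exact: cvg_cst|exact: cvg_id]].
rewrite /tri_fourier; case: eqP => [b0|/eqP b0].
  have dl (x : R) : is_derive x 1 (fun s => cos c * (s + s ^+ 2 / (2 * h)))
      (cos (c + b * x) * (1 + x / h)).
    by apply: is_derive_eq; rewrite b0 mul0r addr0 /GRing.scale/=; field.
  have dr (x : R) : is_derive x 1 (fun s => cos c * (s - s ^+ 2 / (2 * h)))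
      (cos (c + b * x) * (1 - x / h)).
    by apply: is_derive_eq; rewrite b0 mul0r addr0 /GRing.scale/=; field.
  by rewrite (integral_tri h0 cc dl dr); congr (_%:E); field.
have dl (x : R) : is_derive x 1
    (fun s => (1 + s / h) * sin (c + b * s) / b + cos (c + b * s) / (h * b ^+ 2))
    (cos (c + b * x) * (1 + x / h)).
  by apply: is_derive_eq; rewrite /GRing.scale/=; field; rewrite b0 hN0.
have dr (x : R) : is_derive x 1
    (fun s => (1 - s / h) * sin (c + b * s) / b - cos (c + b * s) / (h * b ^+ 2))
    (cos (c + b * x) * (1 - x / h)).
  by apply: is_derive_eq; rewrite /GRing.scale/=; field; rewrite b0 hN0.
rewrite (integral_tri h0 cc dl dr) mulr0 addr0 mul0r !addr0 !subr0 mulrN.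
by rewrite sinB cosB sinD cosD; congr (_%:E); field; rewrite b0 hN0.
Qed.

End triangle_weight.

(** * Positive definite functions *)

Section positive_definite.
Context {R : realType} {n : nat}.
Implicit Types f g : 'rV[R]_n -> R.

(* The closure of the characters under positive combinations and bounded
   limits stands in for Bochner's theorem. *)
Inductive posdef : ('rV[R]_n -> R) -> Prop :=
| posdef_cos a : posdef (fun v => cos (dotv a v))
| posdef_scale c f : 0 <= c -> posdef f -> posdef (fun v => c * f v)
| posdef_add f g : posdef f -> posdef g -> posdef (fun v => f v + g v)
| posdef_lim (F : nat -> 'rV[R]_n -> R) f M : (forall k, posdef (F k)) ->
    (forall k v, `|F k v| <= M) -> (forall v, F k v @[k --> \oo] --> f v) ->
    posdef f.

Lemma posdef_ext f g : f =1 g -> posdef f -> posdef g.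
Proof. by move=> /funext ->. Qed.

Lemma posdef_bounded f : posdef f -> exists M, forall v, `|f v| <= M.
Proof.
elim=> [a|c {}f c0 _ [M fM]|{}f g _ [M fM] _ [M' gM]|F {}f M _ _ FM Ff].
- by exists 1 => v; exact: cos_max.
- by exists (c * M) => v; rewrite normrM ger0_norm// ler_wpM2l.
- by exists (M + M') => v; rewrite (le_trans (ler_normD _ _))// lerD.
- exists M => v; have /cvg_norm nf := Ff v.
  rewrite -(cvg_lim _ nf)//; apply: limr_le; last by apply: nearW => k; exact: FM.
  by apply/cvg_ex; exists `|f v|.
Qed.

Lemma posdef_measurable f : posdef f -> measurable_fun setT f.
Proof.
elim=> [a|c {}f c0 _ mf|{}f g _ mf _ mg|F {}f M _ mF FM Ff].
- by apply: (measurable_comp _ _ measurable_cos) => //; exact: measurable_dotv.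
- exact: measurable_funM.
- exact: measurable_funD.
- by apply: (measurable_fun_cvg mF) => v _; exact: Ff.
Qed.

Lemma posdef_cst c : 0 <= c -> posdef (fun=> c).
Proof.
move=> c0; apply: posdef_ext (posdef_scale c0 (posdef_cos 0)) => v.
by rewrite /dotv big1 ?cos0 ?mulr1// => i _; rewrite mxE mul0r.
Qed.

Lemma posdef_mul f g : posdef f -> posdef g -> posdef (fun v => f v * g v).
Proof.
move=> pf pg.
(* Characters come first, by cos a cos b = (cos (a + b) + cos (a - b)) / 2. In the induction on [f]
   that follows, [g] is fixed and its bound [M] controls the limits. *)
have pcos (a : 'rV[R]_n) h : posdef h -> posdef (fun v => cos (dotv a v) * h v).
  elim=> [b|c {}f0 c0 _ ih|f0 g0 _ ihf _ ihg|F f0 M _ ih FM Ff].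
  - have h2 : (0 : R) <= 2^-1 by rewrite invr_ge0.
    apply: posdef_ext (posdef_scale h2
      (posdef_add (posdef_cos (a + b)) (posdef_cos (a - b)))) => v.
    have -> : dotv (a + b) v = dotv a v + dotv b v.
      by rewrite /dotv -big_split; apply: eq_bigr => i _; rewrite !mxE mulrDl.
    have -> : dotv (a - b) v = dotv a v - dotv b v.
      by rewrite /dotv -sumrB; apply: eq_bigr => i _; rewrite !mxE mulrBl.
    by rewrite cosD cosB; field.
  - by apply: posdef_ext (posdef_scale c0 ih) => v; rewrite mulrCA.
  - by apply: posdef_ext (posdef_add ihf ihg) => v; rewrite mulrDr.
  - apply: (posdef_lim (M := M) ih) => [k v|v].
      by rewrite normrM (le_trans _ (FM k v))// ler_piMl// cos_max.
    by apply: cvgM => //; exact: cvg_cst.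
have [M gM] := posdef_bounded pg.
elim: pf => [a|c {}f c0 _ ih|f0 g0 _ ihf _ ihg|F f0 M' _ ih FM Ff].
- exact: pcos.
- by apply: posdef_ext (posdef_scale c0 ih) => v; rewrite mulrA.
- by apply: posdef_ext (posdef_add ihf ihg) => v; rewrite mulrDl.
- apply: (posdef_lim (M := M' * M) ih) => [k v|v].
    by rewrite normrM ler_pM.
  by apply: cvgM => //; exact: cvg_cst.
Qed.

Lemma posdef_sum m (F : nat -> 'rV[R]_n -> R) : (forall k, posdef (F k)) ->
  posdef (fun v => \sum_(k < m) F k v).
Proof.
move=> pF; elim: m => [|m ih].
  by apply: posdef_ext (posdef_cst (lexx 0)) => v; rewrite big_ord0.
by apply: posdef_ext (posdef_add ih (pF m)) => v; rewrite big_ord_recr.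
Qed.

Lemma posdef_pow f m : posdef f -> posdef (fun v => f v ^+ m).
Proof.
move=> pf; elim: m => [|m ih].
  exact: posdef_ext (posdef_cst ler01).
by apply: posdef_ext (posdef_mul pf ih) => v; rewrite exprS.
Qed.

(** The partial sums of the exponential series have nonnegative coefficients, and a bound [M] of [f]
    bounds them all by exp M, as the limit clause demands. *)
Lemma posdef_exp f : posdef f -> posdef (fun v => expR (f v)).
Proof.
move=> pf; have [M fM] := posdef_bounded pf.
have cf (x : R) := is_cvg_series_exp_coeff x.
apply: (posdef_lim (F := fun k v => series (exp_coeff (f v)) k) (M := expR M)).
- move=> k; have c0 i : 0 <= (i`!%:R : R)^-1 by rewrite invr_ge0.
  apply: posdef_ext (posdef_sum k (fun i => posdef_scale (c0 i) (posdef_pow i pf))) => v.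
  by rewrite /series/= big_mkord; apply: eq_bigr => i _; rewrite /exp_coeff/= mulrC.
- move=> k v; rewrite (@le_trans _ _ (series (exp_coeff `|f v|) k))//.
    rewrite /series/= (le_trans (ler_norm_sum _ _ _))//.
    apply: ler_sum => i _; rewrite /exp_coeff/= normrM normrX ler_wpM2l//.
    by rewrite ger0_norm.
  rewrite (@le_trans _ _ (expR `|f v|)) ?ler_expR//.
  apply: nondecreasing_cvgn_le; last exact: cf.
  by apply: nondecreasing_series => i _ _; exact: exp_coeff_ge0.
- by move=> v; exact: cf.
Qed.

(** A character gives a product of Fejer kernels; limits pass by dominated convergence, for which
    the weight supplies the integrable majorant. *)
Lemma posdef_integral_ge0 h f : 0 < h -> posdef f ->
  (0 <= \int[lebesgue_rV n]_v (f v * \prod_(i < n) tri h (v 0 i))%:E)%E.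
Proof.
move=> h0.
have trW : (\int[@lebesgue_measure R]_s (tri h s)%:E = h%:E)%E.
  have := integral_cos_tri 0 0 h0; rewrite cos0 mul1r /tri_fourier eqxx => <-.
  by apply: eq_integral => s _; rewrite mul0r addr0 cos0 mul1r.
have wi := integrable_prod_rV n (measurable_tri h) (tri_ge0 h) trW.
have wM : measurable_fun setT (fun v : 'rV[R]_n => \prod_(i < n) tri h (v 0 i)).
  exact: measurable_prod_rV (measurable_tri h).
have p0 (v : 'rV[R]_n) : 0 <= \prod_(i < n) tri h (v 0 i).
  by apply: prodr_ge0 => i _; exact: tri_ge0.
have fi g : posdef g ->
    (lebesgue_rV n).-integrable setT (fun v => (g v * \prod_(i < n) tri h (v 0 i))%:E).
  move=> pg; have [M gM] := posdef_bounded pg.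
  apply: (le_integrable measurableT _ _ (integrableZl measurableT M wi)).
    by apply/measurable_EFinP/measurable_funM => //; exact: posdef_measurable.
  move=> v _; rewrite lee_fin !normrM ler_wpM2r//.
  by rewrite (le_trans (gM v))// ler_norm.
elim=> [a|c {}f c0 pf ih|{}f g pf ihf pg ihg|F {}f M pF ih FM Ff].
- have := integral_cos_prod_rV 0 a (measurable_tri h) (tri_ge0 h) trW
    (fun c b => integral_cos_tri c b h0).
  under eq_integral do rewrite add0r; move=> ->; rewrite cos0 mul1r lee_fin.
  by apply: prodr_ge0 => i _; exact: tri_fourier_ge0.
- under eq_integral do rewrite -mulrA EFinM.
  by rewrite integralZl ?mule_ge0 ?lee_fin//; exact: fi.
- under eq_integral do rewrite mulrDl EFinD.
  by rewrite (integralD measurableT (fi _ pf) (fi _ pg)) adde_ge0.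
- have pf : posdef f by exact: posdef_lim Ff.
  have cF v : setT v -> (F k v * \prod_(i < n) tri h (v 0 i))%:E @[k --> \oo] -->
      (f v * \prod_(i < n) tri h (v 0 i))%:E.
    by move=> _; apply: cvg_EFin; [exact: nearW|apply: cvgM; [exact: Ff|exact: cvg_cst]].
  have bF v k : setT v -> (`|(F k v * \prod_(i < n) tri h (v 0 i))%:E| <=
      M%:E * (\prod_(i < n) tri h (v 0 i))%:E)%E.
    by move=> _; rewrite lee_fin normrM (ger0_norm (p0 v)) ler_wpM2r.
  have [_ _ cv] := dominated_convergence measurableT
    (fun k => measurable_int _ (fi _ (pF k))) (measurable_int _ (fi _ pf))
    (aeW _ cF) (integrableZl measurableT M wi) (aeW _ bF).
  rewrite -(cvg_lim _ cv)//; apply: lime_ge; first by apply/cvg_ex; eexists; exact: cv.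
  exact: nearW.
Qed.

End positive_definite.

(** * Taylor polynomials of (1 - x)^al *)

Section binomial_approximation.
Context {R : realType}.
Implicit Types (al x : R) (m : nat).

(* binr al k / (k + 1) is the coefficient of x^(k+1) in 1 - (1 - x)^al. *)
Fixpoint binr al m : R :=
  if m is k.+1 then binr al k * (1 - al / k.+1%:R) else al.

Definition binp al m x : R := 1 - \sum_(k < m) binr al k / k.+1%:R * x ^+ k.+1.

(** This sign is the reason for theta <= 2: for al = theta / 2 <= 1 the series of 1 - (1 - f)^al
    preserves positive definiteness. *)
Lemma binr_ge0 al m : 0 <= al <= 1 -> 0 <= binr al m.
Proof.
move=> /andP[a0 a1]; elim: m => //= m ih; rewrite mulr_ge0// subr_ge0.
by rewrite ler_pdivrMr// mul1r (le_trans a1)// ler1n.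
Qed.

Lemma binr_le1 al m : 0 <= al <= 1 -> binr al m <= 1.
Proof.
move=> /andP[a0 a1]; elim: m => //= m ih; rewrite mulr_ile1 ?binr_ge0 ?a0//.
  by rewrite subr_ge0 ler_pdivrMr// mul1r (le_trans a1)// ler1n.
by rewrite gerBl divr_ge0.
Qed.

(* (1 - x)^al solves the homogeneous equation (1 - x) P' + al P = 0. *)
Lemma is_derive_binp al m x : exists2 P' : R, is_derive x 1 (binp al m) P' &
  (1 - x) * P' + al * binp al m x = binr al m * x ^+ m.
Proof.
elim: m => [|m].
  have -> : binp al 0 = cst 1.
    by apply/funext => y; rewrite /binp big_ord0 subr0.
  by exists 0; [exact: is_derive_cst|rewrite /=; ring].
have -> : binp al m.+1 =
    fun y => binp al m y - binr al m / m.+1%:R * y ^+ m.+1.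
  by apply/funext => y; rewrite /binp big_ord_recr/= opprD addrA.
move: (binp al m) => f [P' dP PE].
have m0 : m.+1%:R != 0 :> R by rewrite pnatr_eq0.
exists (P' - binr al m * x ^+ m).
  have dX : is_derive x 1 (fun y : R => y ^+ m.+1) (m.+1%:R * x ^+ m).
    have := is_deriveX m.+1 (is_derive_id x (1 : R)).
    rewrite /GRing.scale/= mulr1; congr is_derive.
    by apply/funext => y; rewrite fctE.
  have -> : P' - binr al m * x ^+ m =
      P' - binr al m / m.+1%:R * (m.+1%:R * x ^+ m) by field.
  exact: is_deriveB dP (is_deriveZ (binr al m / m.+1%:R) dX).
rewrite !mulrBr addrACA PE/= exprS.
by field.
Qed.

(** Divided by (1 - x)^al, the polynomial becomes [g], whose derivative collapses to the single term
    [dg] by the equation in [is_derive_binp]. The mean value theorem, started at [g 0 = 1], gives an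
    exact remainder with its sign. *)
Lemma binp_bounds al m x : 0 < al <= 1 -> 0 <= x < 1 ->
  (1 - x) `^ al <= binp al m x <= (1 - x) `^ al + x ^+ m / (1 - x).
Proof.
move=> /andP[al0 al1] /andP[]; rewrite le_eqVlt => /predU1P[<- _|x0 x1].
  have -> : binp al m 0 = 1.
    by rewrite /binp big1 ?subr0// => i _; rewrite exprS mul0r mulr0.
  by rewrite subr0 powR1 lexx/= lerDl divr_ge0// exprn_ge0.
have al01 : 0 <= al <= 1 by rewrite ltW.
pose g y := binp al m y * expR (- al * ln (1 - y)).
pose dg y := expR (- al * ln (1 - y)) * (binr al m * y ^+ m / (1 - y)).
have dgE (y : R) : y < 1 -> is_derive y 1 g (dg y).
  move=> y1; have [P' dP PE] := is_derive_binp al m y.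
  have y1' : 0 < 1 - y by rewrite subr_gt0.
  have dl : is_derive y 1 (fun y => ln (1 - y)) (- (1 - y)^-1).
    have d1 : is_derive y 1 (fun y : R => 1 - y) (0 - 1).
      exact: is_deriveB (is_derive_cst _ _ _) (is_derive_id _ _).
    have := @is_derive1_comp _ (@ln R) (fun y => 1 - y) y _ _ (is_derive1_ln y1') d1.
    by rewrite sub0r mulrN1.
  have de : is_derive y 1 (fun y => expR (- al * ln (1 - y)))
      (expR (- al * ln (1 - y)) * (al / (1 - y))).
    have dm : is_derive y 1 (fun y => - al * ln (1 - y)) (al / (1 - y)).
      have := is_deriveZ (- al) dl; rewrite /GRing.scale/= mulrNN; exact.
    exact: (@is_derive1_comp _ (@expR R) (fun y => - al * ln (1 - y)) y _ _ (is_derive_expR _) dm).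
  have -> : dg y = binp al m y * (expR (- al * ln (1 - y)) * (al / (1 - y))) +
      expR (- al * ln (1 - y)) * P'.
    by rewrite /dg -PE; field; rewrite lt0r_neq0.
  exact: is_deriveM dP de.
have cg : {within `[0, x], continuous g}.
  apply: derivable_within_continuous => y; rewrite in_itv/= => /andP[_ yx].
  by have [] := dgE y (le_lt_trans yx x1).
have [|c /[!in_itv]/= /andP[c0 cx] gE] := @MVT _ g dg 0 x x0 _ cg.
  by move=> y; rewrite in_itv/= => /andP[_ yx]; exact/dgE/(lt_trans yx).
have g0 : g 0 = 1.
  rewrite /g subr0 ln1 mulr0 expR0 mulr1 /binp big1 ?subr0// => i _.
  by rewrite exprS mul0r mulr0.
have px : 0 < 1 - x by rewrite subr_gt0.
have pc : 0 < 1 - c by rewrite subr_gt0 (lt_trans cx).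
have binpE : binp al m x = (1 - x) `^ al + (1 - x) `^ al * (dg c * x).
  have -> : dg c * x = g x - 1 by rewrite -g0 gE subr0.
  have EE : (1 - x) `^ al * expR (- al * ln (1 - x)) = 1.
    by rewrite /powR gt_eqF// -expRD mulNr subrr expR0.
  by rewrite /g mulrBr mulrCA EE; ring.
have dg0 : 0 <= dg c * x.
  rewrite mulr_ge0 ?(ltW x0)// /dg mulr_ge0 ?expR_ge0// divr_ge0 ?(ltW pc)//.
  by rewrite mulr_ge0 ?binr_ge0// exprn_ge0// ltW.
rewrite binpE lerDl mulr_ge0 ?powR_ge0//= lerD2l.
(* The remainder is ((1 - x) / (1 - c))^al times [binr al m] c^m x / (1 - c) with 0 < c < x < 1: the
   first factor is at most 1, the rest at most x^m / (1 - x). *)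
rewrite /dg -!mulrA mulrA -[leRHS]mul1r; apply: ler_pM.
- by rewrite mulr_ge0 ?powR_ge0 ?expR_ge0.
- by rewrite !mulr_ge0 ?binr_ge0 ?exprn_ge0 ?invr_ge0// ltW.
- rewrite (@le_trans _ _ ((1 - c) `^ al * expR (- al * ln (1 - c))))//.
    rewrite ler_wpM2r ?expR_ge0// ge0_ler_powR ?nnegrE ?(ltW al0) ?(ltW px) ?(ltW pc)//.
    by rewrite lerD2l lerN2 ltW.
  by rewrite /powR gt_eqF// -expRD mulNr subrr expR0.
- have c0m : 0 <= c ^+ m by rewrite exprn_ge0// ltW.
  have cx0 : 0 <= (1 - c)^-1 * x by rewrite mulr_ge0 ?invr_ge0// ltW.
  rewrite (@le_trans _ _ (c ^+ m * ((1 - c)^-1 * x)))//.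
    by rewrite ler_piMl ?binr_le1// mulr_ge0.
  apply: ler_pM => //; first by rewrite lerXn2r ?nnegrE ?(ltW c0) ?(ltW x0) ?(ltW cx).
  rewrite -[leRHS]mulr1 ler_pM ?invr_ge0 ?(ltW pc) ?(ltW x0) ?(ltW x1)//.
  by rewrite lef_pV2 ?posrE// lerD2l lerN2 ltW.
Qed.

End binomial_approximation.

(** * Positive definiteness of exp (- t |v|^theta) *)

Section stable_posdef.
Context {R : realType}.

Lemma normr_sin_le (x : R) : `|sin x| <= `|x|.
Proof.
have pos (y : R) : 0 < y -> `|sin y| <= y.
  move=> y0; have [|c _] := @MVT _ (@sin R) cos 0 y y0 (fun z _ => is_derive_sin z).
    by apply: continuous_subspaceT; exact: continuous_sin.
  rewrite sin0 !subr0 => ->; rewrite normrM (gtr0_norm y0) ler_piMl ?cos_max//.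
  exact: ltW.
have [x0|x0|->] := ltgtP x 0; last by rewrite sin0.
- by rewrite -normrN -sinN -(normrN x) (gtr0_norm (x := - x)) ?pos ?oppr_gt0.
- by rewrite (gtr0_norm x0) pos.
Qed.

Lemma cvg_mul_sin (y : R) : k.+1%:R * sin (y / k.+1%:R) @[k --> \oo] --> y.
Proof.
have d0 : is_derive (0 : R) 1 (fun s => sin (s * y)) (cos (0 * y) * y).
  by apply: is_derive_eq; rewrite /GRing.scale/=; ring.
have : h^-1 *: (((fun s => sin (s * y)) \o shift 0) (h *: (1 : R)) - sin (0 * y))
    @[h --> (0:R)^'] --> cos (0 * y) * y.
  have [d1 d2] := d0; rewrite -d2; exact: d1.
rewrite mul0r cos0 mul1r sin0 => cv.
have k0 : (fun k : nat => (k.+1%:R : R)^-1) @ \oo --> (0 : R)^'.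
  move=> A /(@cvg_harmonic R _)[N _ AN]; exists N => // k /AN; apply.
  by rewrite /harmonic/= invr_eq0 pnatr_eq0.
have -> : (fun k => k.+1%:R * sin (y / k.+1%:R)) =
    (fun h => h^-1 *: (((fun s => sin (s * y)) \o shift 0) (h *: (1 : R)) - 0)) \o
    (fun k : nat => (k.+1%:R : R)^-1).
  apply/funext => k.
  by rewrite /= /GRing.scale/= invrK mulr1 addr0 subr0 [y / _]mulrC.
exact: cvg_comp k0 cv.
Qed.

Context {n : nat}.
Local Notation rV := 'rV[R]_n.

(** With this [K], K_k (1 - cos (v_i / (k + 1))) = w (2 (k + 1) sin (v_i / (2 (k + 1))))^2, which
    tends to w v_i^2. *)
Lemma posdef_gauss1 (w : R) i : 0 <= w ->
  posdef (fun v : rV => expR (- w * v 0 i ^+ 2)).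
Proof.
move=> w0.
pose K (k : nat) : R := 2 * w * k.+1%:R ^+ 2.
have K0 k : 0 <= K k by rewrite /K !mulr_ge0.
apply: (posdef_lim (M := 1)
  (F := fun k v => expR (- K k * (1 - cos (v 0 i / k.+1%:R))))).
- move=> k; apply: posdef_ext (posdef_scale (expR_ge0 (- K k))
    (posdef_exp (posdef_scale (K0 k) (posdef_cos (k.+1%:R^-1 *: delta_mx 0 i))))) => v.
  rewrite -expRD mulrBr mulr1 mulNr opprK; congr (expR (_ + _ * cos _)).
  rewrite /dotv (bigD1 i)//= !mxE !eqxx big1 ?addr0 => [|j ji].
    by rewrite mulr1 mulrC.
  by rewrite !mxE (negbTE ji) andbF mulr0 mul0r.
- move=> k v; rewrite ger0_norm ?expR_ge0// expR_le1 mulNr oppr_le0.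
  by rewrite mulr_ge0// subr_ge0 cos_le1.
- move=> v; apply: continuous_cvg; first exact: continuous_expR.
  have -> : (fun k => - K k * (1 - cos (v 0 i / k.+1%:R))) =
      (fun k => - w * (2 * (k.+1%:R * sin ((v 0 i / 2) / k.+1%:R))) ^+ 2).
    apply/funext => k; have -> : v 0 i / k.+1%:R =
      (v 0 i / 2) / k.+1%:R + (v 0 i / 2) / k.+1%:R by field.
    by rewrite cosD -!expr2 cos2sin2 /K; ring.
  apply: cvgM; first exact: cvg_cst.
  have -> : v 0 i ^+ 2 = (2 * (v 0 i / 2)) ^+ 2 by congr (_ ^+ _); field.
  by apply: cvgM; (apply: cvgM; [exact: cvg_cst|exact: cvg_mul_sin]).
Qed.

Lemma posdef_gauss (w : R) : 0 <= w ->
  posdef (fun v : rV => expR (- w * \sum_(i < n) v 0 i ^+ 2)).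
Proof.
move=> w0; apply: (@posdef_ext _ _ (fun v => \prod_(i < n) expR (- w * v 0 i ^+ 2))).
  by move=> v; rewrite mulr_sumr expR_sum.
have : forall s : seq 'I_n, posdef (fun v : rV => \prod_(i <- s) expR (- w * v 0 i ^+ 2)).
  elim=> [|i s ih]; first by apply: posdef_ext (posdef_cst ler01) => v; rewrite big_nil.
  by apply: posdef_ext (posdef_mul (posdef_gauss1 i w0) ih) => v; rewrite big_cons.
exact.
Qed.

(** The exponent is - s plus a polynomial in [f] with nonnegative coefficients. *)
Lemma posdef_binp (s al : R) (f : rV -> R) m : 0 <= s -> 0 <= al <= 1 ->
  posdef f -> posdef (fun v => expR (- s * binp al m (f v))).
Proof.
move=> s0 al01 pf.
have c0 k : 0 <= s * (binr al k / k.+1%:R) by rewrite mulr_ge0// divr_ge0// binr_ge0.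
apply: posdef_ext (posdef_scale (expR_ge0 (- s))
  (posdef_exp (posdef_sum m (fun k => posdef_scale (c0 k) (posdef_pow k.+1 pf))))) => v.
rewrite -expRD /binp mulrBr mulr1 mulNr opprK mulr_sumr; congr (expR (_ + _)).
by apply: eq_bigr => k _; rewrite !mulrA.
Qed.

Lemma cvg_binp (al x : R) : 0 < al <= 1 -> 0 <= x < 1 ->
  binp al m x @[m --> \oo] --> (1 - x) `^ al.
Proof.
move=> al01 /andP[x0 x1].
apply: (@squeeze_cvgr _ _ _ _ (fun=> (1 - x) `^ al)
  (fun m => (1 - x) `^ al + x ^+ m / (1 - x))).
- by apply: nearW => m; apply: binp_bounds => //; rewrite x0.
- exact: cvg_cst.
- rewrite -[X in _ --> X]addr0 -[X in _ --> _ + X](mul0r (1 - x)^-1).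
  apply: cvgD; first exact: cvg_cst.
  by apply: cvgM; [apply: cvg_expr; rewrite ger0_norm|exact: cvg_cst].
Qed.

Lemma posdef_onem_powR (s al : R) (f : rV -> R) : 0 <= s -> 0 < al <= 1 ->
  (forall v, 0 <= f v < 1) -> posdef f ->
  posdef (fun v => expR (- s * (1 - f v) `^ al)).
Proof.
move=> s0 al01 f01 pf; have /andP[al0 al1] := al01.
apply: (posdef_lim (M := 1) (F := fun m v => expR (- s * binp al m (f v)))).
- by move=> m; apply: posdef_binp => //; rewrite ltW.
- move=> m v; rewrite ger0_norm ?expR_ge0// expR_le1 mulNr oppr_le0 mulr_ge0//.
  by have /andP[+ _] := binp_bounds m al01 (f01 v); apply: le_trans; exact: powR_ge0.
- move=> v; apply: continuous_cvg; first exact: continuous_expR.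
  by apply: cvgM; [exact: cvg_cst|exact: cvg_binp].
Qed.

Lemma cvg_powR (al : R) (u : nat -> R) (l : R) : 0 < al -> (forall k, 0 <= u k) ->
  u k @[k --> \oo] --> l -> (u k) `^ al @[k --> \oo] --> l `^ al.
Proof.
move=> al0 u0 ul.
have [l0|l0] := ltP 0 l.
  have cp : {for l, continuous (fun x : R => x `^ al)}.
    apply/differentiable_continuous/derivable1_diffP.
    by apply: derivable_powR; rewrite in_itv/= l0.
  exact: continuous_cvg cp ul.
have {l0} l0 : l = 0.
  apply/eqP; rewrite eq_le l0/= -(cvg_lim _ ul)//.
  by apply: limr_ge; [apply/cvg_ex; exists l|exact: nearW].
rewrite l0 powR0 ?gt_eqF//; apply/cvgr0Pnorm_lt => e e0.
rewrite l0 in ul; have e1 : 0 < e `^ al^-1 by rewrite powR_gt0.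
have [M _ HM] := @cvgr0_norm_lt _ _ _ _ _ _ ul _ e1.
exists M => // k /HM /=; rewrite !ger0_norm ?powR_ge0// => uk.
have -> : e = (e `^ al^-1) `^ al by rewrite -powRrM mulVf ?gt_eqF// powRr1// ltW.
by rewrite gt0_ltr_powR ?nnegrE// ltW.
Qed.

Lemma posdef_stable (t al : R) : 0 <= t -> 0 < al <= 1 ->
  posdef (fun v : rV => expR (- t * (\sum_(i < n) v 0 i ^+ 2) `^ al)).
Proof.
move=> t0 al01; have /andP[al0 _] := al01.
pose lam (v : rV) := \sum_(i < n) v 0 i ^+ 2.
have lam0 v : 0 <= lam v by apply: sumr_ge0 => i _; rewrite sqr_ge0.
(* The summand 1 / (k + 1) keeps [phi k] strictly below 1 also at v = 0, as [posdef_onem_powR]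
   requires; it vanishes in the limit. *)
pose phi k v := expR (- (lam v + k.+1%:R^-1) / k.+1%:R).
have phi01 k v : 0 <= phi k v < 1.
  by rewrite expR_ge0 expR_lt1 mulNr oppr_lt0 divr_gt0// ltr_wpDl.
have pphi k : posdef (phi k).
  apply: posdef_ext (posdef_scale (expR_ge0 (- k.+1%:R^-1 / k.+1%:R))
    (posdef_gauss (w := k.+1%:R^-1) _)) => [v|]; last by rewrite invr_ge0.
  by rewrite -expRD /phi /lam; congr expR; ring.
apply: (posdef_lim (M := 1) (F := fun k v => expR (- (t * k.+1%:R `^ al) * (1 - phi k v) `^ al))).
- by move=> k; apply: posdef_onem_powR => //; rewrite mulr_ge0 ?powR_ge0.
- move=> k v; rewrite ger0_norm ?expR_ge0// expR_le1 mulNr oppr_le0.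
  by rewrite !mulr_ge0 ?powR_ge0.
- move=> v; apply: continuous_cvg; first exact: continuous_expR.
  have -> : (fun k => - (t * k.+1%:R `^ al) * (1 - phi k v) `^ al) =
      (fun k => - t * (k.+1%:R * (1 - phi k v)) `^ al).
    apply/funext => k; rewrite powRM//; first by ring.
    by rewrite subr_ge0 ltW//; have /andP[] := phi01 k v.
  apply: cvgM; first exact: cvg_cst.
  apply: cvg_powR => // [k|].
    by rewrite mulr_ge0// subr_ge0 ltW//; have /andP[] := phi01 k v.
  have hk k : (0 : R) < k.+1%:R^-1 by rewrite invr_gt0.
  have ch : (fun k : nat => (k.+1%:R : R)^-1) @ \oo --> (0 : R) := @cvg_harmonic R.
  have cl : lam v + k.+1%:R^-1 @[k --> \oo] --> lam v.
    by rewrite -[X in _ --> X]addr0; apply: cvgD => //; exact: cvg_cst.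
  (* The squeeze is x / (1 + x) <= 1 - exp (- x) <= x, multiplied by k + 1. *)
  apply: (@squeeze_cvgr _ _ _ _ (fun k => (lam v + k.+1%:R^-1) *
      (1 + (lam v + k.+1%:R^-1) * k.+1%:R^-1)^-1) (fun k => lam v + k.+1%:R^-1)) => //.
    apply: nearW => k; set x := (lam v + k.+1%:R^-1) / k.+1%:R.
    have x0 : 0 < x by rewrite divr_gt0// ltr_wpDl.
    have -> : lam v + k.+1%:R^-1 = k.+1%:R * x by rewrite /x; field.
    have -> : phi k v = (expR x)^-1 by rewrite -expRN /phi /x mulNr.
    rewrite -mulrA !ler_pM2l//.
    have ex : 1 + x <= expR x := expR_ge1Dx x.
    have x1 : 0 < 1 + x by rewrite addr_gt0.
    apply/andP; split.
      have -> : x / (1 + x) = 1 - (1 + x)^-1 by field; exact: lt0r_neq0.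
      by rewrite lerD2l lerN2 lef_pV2 ?posrE ?expR_gt0.
    by rewrite lerBlDr -lerBlDl -expRN (le_trans _ (expR_ge1Dx _)).
  have -> : \sum_(i < n) v 0 i ^+ 2 = lam v / (1 + lam v * 0) by rewrite mulr0 addr0 divr1.
  apply: cvgM => //; apply: cvgV; first by rewrite mulr0 addr0 oner_eq0.
  by apply: cvgD; [exact: cvg_cst|exact: cvgM].
Qed.

End stable_posdef.

(** * Decay of the stable characteristic function *)

Section heat_kernel_bounds.
Context {R : realType}.
Local Notation leb := (@lebesgue_measure R).

Lemma enorm_ge0 n (v : 'rV[R]_n) : 0 <= enorm v.
Proof. exact: sqrtr_ge0. Qed.

Lemma enorm_sqr n (v : 'rV[R]_n) : enorm v ^+ 2 = \sum_(i < n) v 0 i ^+ 2.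
Proof. by rewrite sqr_sqrtr// sumr_ge0// => i _; rewrite sqr_ge0. Qed.

Lemma ler_coord_enorm n (v : 'rV[R]_n) i : `|v 0 i| <= enorm v.
Proof.
rewrite -(@ler_pXn2r _ 2)// ?nnegrE ?enorm_ge0// enorm_sqr real_normK ?num_real//.
by rewrite (bigD1 i)//= lerDl sumr_ge0// => j _; rewrite sqr_ge0.
Qed.

Lemma enormX n (v : 'rV[R]_n) (theta : R) :
  enorm v `^ theta = (\sum_(i < n) v 0 i ^+ 2) `^ (theta / 2).
Proof.
rewrite -enorm_sqr -powR_mulrn ?enorm_ge0// -powRrM; congr (_ `^ _).
by field.
Qed.

Definition stable_char n (theta t : R) (v : 'rV[R]_n) : R :=
  expR (- (t * enorm v `^ theta)).

Lemma posdef_stable_char n (theta t : R) : 0 < theta <= 2 -> 0 <= t ->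
  posdef (@stable_char n theta t).
Proof.
move=> /andP[th0 th2] t0.
apply: posdef_ext (posdef_stable t0 (al := theta / 2) _) => [v|].
  by rewrite /stable_char enormX mulNr.
by rewrite divr_gt0//= ler_pdivrMr// mul1r.
Qed.

Lemma heat_kernelE n (theta t : R) (x : 'rV[R]_n) :
  heat_kernel theta x t = (2 * pi) ^- n *
    fine (\int[lebesgue_rV n]_v (cos (dotv x v) * stable_char theta t v)%:E).
Proof.
rewrite /heat_kernel /heat_kernelC /cintegral /Rintegral /=.
rewrite [0 * fine _]mul0r subr0; congr (_ * fine _); apply: eq_integral => v _.
by rewrite /stable_char !(mul0r, mul1r, mulr0, subr0, add0r, addr0, sub0r, oppr0) mulrC.
Qed.

(** Products of this weight over the coordinates serve as integrable majorants at time a^theta; they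
    integrate to (pi / a)^n, the power of [a] that the kernel bound needs. *)
Definition cauchy_weight (a s : R) : R := (1 + (a * s) ^+ 2)^-1.

Lemma cauchy_den_gt0 (a s : R) : 0 < 1 + (a * s) ^+ 2.
Proof. by rewrite ltr_wpDr ?sqr_ge0. Qed.

Lemma cauchy_weight_ge0 a s : 0 <= cauchy_weight a s.
Proof. by rewrite invr_ge0 ltW// cauchy_den_gt0. Qed.

Lemma continuous_cauchy_weight a : continuous (cauchy_weight a).
Proof.
move=> s; apply: cvgV; first by rewrite lt0r_neq0// cauchy_den_gt0.
apply: cvgD; first exact: cvg_cst.
by apply: cvgM; (apply: cvgM; [exact: cvg_cst|exact: cvg_id]).
Qed.

Lemma integral_cauchy_weight (a : R) : 0 < a ->
  (\int[leb]_s (cauchy_weight a s)%:E = (pi / a)%:E)%E.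
Proof.
move=> a0; have cw := @continuous_cauchy_weight a.
rewrite ge0_symfun_integralT//; last 2 first.
- by move=> s; exact: cauchy_weight_ge0.
- by move=> s; rewrite /cauchy_weight/= mulrN sqrrN.
pose F s : R := a^-1 * atan (a * s).
have dF (s : R) : is_derive s 1 F (cauchy_weight a s).
  have d1 : is_derive s 1 (fun s => a * s) (a * 1).
    have := is_deriveZ a (is_derive_id s (1 : R)); rewrite /GRing.scale/=.
    by congr is_derive; apply/funext.
  have d2 := @is_derive1_comp _ (@atan R) (fun s => a * s) s _ _ (is_derive1_atan _) d1.
  have -> : cauchy_weight a s = a^-1 * ((1 + (a * s) ^+ 2)^-1 * (a * 1)).
    by rewrite /cauchy_weight; field; rewrite !lt0r_neq0// cauchy_den_gt0.
  have := is_deriveZ a^-1 d2; rewrite /GRing.scale/=.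
  by congr is_derive; apply/funext.
have cF : continuous F.
  move=> x; apply/differentiable_continuous/derivable1_diffP.
  by have := dF x => -[].
have Fl : F x @[x --> +oo] --> a^-1 * (pi / 2).
  apply: cvgM; first exact: cvg_cst.
  apply: (cvg_comp (fun s => a * s) _ _ (@cvgy_atan R)).
  exact: gt0_cvgMry.
rewrite -set_itvcy.
rewrite (@ge0_continuous_FTC2y _ (cauchy_weight a) F 0 _ _ _ Fl)//.
- by rewrite /F mulr0 atan0 mulr0 sube0 -EFinM; congr (_%:E); field; exact: lt0r_neq0.
- by move=> s _; exact: cauchy_weight_ge0.
- exact: continuous_subspaceT.
- exact/cvg_at_right_filter/cF.
- by move=> s _; rewrite derive1E; exact: derive_val.
Qed.

(** For r > 1 and s = r^theta, exp s >= s^(n+1) / (n+1)! with n + 1 >= 2 M / theta absorbs (1 +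
    r^2)^M <= 2^M r^(2M). *)
Lemma stable_decay (theta : R) (M : nat) : 0 < theta ->
  exists2 C : R, 0 < C & forall r, 0 <= r -> expR (- r `^ theta) * (1 + r ^+ 2) ^+ M <= C.
Proof.
move=> th0.
have [n nM] : exists n : nat, 2 * M%:R / theta <= n.+1%:R.
  exists (Num.truncn (2 * M%:R / theta)); exact/ltW/truncnS_gt.
exists (2 ^+ M * n.+1`!%:R) => [|r r0]; first by rewrite mulr_gt0// ltr0n fact_gt0.
have f1 : (1 : R) <= n.+1`!%:R by rewrite ler1n fact_gt0.
have [r1|r1] := leP r 1.
  rewrite -[leRHS]mulr1 [leRHS]mulrAC mulrC -[leRHS]mulrA; apply: ler_pM.
  - by rewrite exprn_ge0// addr_ge0// sqr_ge0.
  - exact: expR_ge0.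
  - rewrite lerXn2r ?nnegrE ?addr_ge0 ?sqr_ge0// -[leRHS]/(1 + 1) lerD2l.
    by rewrite expr_le1.
  - by rewrite mul1r (le_trans _ f1)// expR_le1 oppr_le0 powR_ge0.
set s := r `^ theta.
have s1 : 1 <= s.
  have <- : 1 `^ theta = 1 :> R by rewrite powR1.
  by rewrite ge0_ler_powR ?nnegrE ?(ltW th0) ?(ltW r1).
rewrite expRN mulrC ler_pdivrMr ?expR_gt0//.
have e1 := expR_ge1Dxn n (ltW (lt_le_trans ltr01 s1)).
rewrite (@le_trans _ _ (2 ^+ M * s ^+ n.+1))//; last first.
  rewrite -mulrA ler_wpM2l//.
  rewrite -ler_pdivrMl ?(lt_le_trans ltr01)// mulrC.
  by rewrite (le_trans _ e1)// lerDr.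
have r2 : (r ^+ 2) ^+ M <= s ^+ n.+1.
  have s0 : 0 <= s := powR_ge0 _ _.
  rewrite -exprM -(powR_mulrn (2 * M) r0) -(powR_mulrn n.+1 s0) /s -powRrM.
  rewrite ler_powR// ?(ltW r1)//.
  by rewrite [theta * _]mulrC natrM -ler_pdivrMr.
apply: le_trans (_ : (2 * r ^+ 2) ^+ M <= _).
  rewrite lerXn2r ?nnegrE ?mulr_ge0 ?addr_ge0 ?sqr_ge0//.
  by rewrite mulr2n mulrDl mul1r lerD2r exprn_ege1// ltW.
by rewrite exprMn ler_wpM2l.
Qed.

End heat_kernel_bounds.

(** * Positivity and lower bound of the heat kernel *)

Section heat_kernel_lower_bound.
Context {R : realType} {n : nat}.
Local Notation rV := 'rV[R]_n.
Local Notation leb := (@lebesgue_rV R n).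

(** [stable_decay] is used with exponent n + 1: n factors 1 + r^2 dominate those of the product, and
    the last one provides the second moment needed in [heat_kernel_ge]. *)
Lemma stable_char_le (theta : R) : 0 < theta ->
  exists2 C : R, 0 < C & forall (a : R) (v : rV), 0 < a ->
    (1 + (a * enorm v) ^+ 2) * stable_char theta (a `^ theta) v <=
    C * \prod_(i < n) cauchy_weight a (v 0 i).
Proof.
move=> th0; have [C C0 HC] := stable_decay n.+1 th0.
exists C => // a v a0; set r := a * enorm v.
have r0 : 0 <= r by rewrite mulr_ge0 ?enorm_ge0// ltW.
have -> : stable_char theta (a `^ theta) v = expR (- r `^ theta).
  by rewrite /stable_char -powRM ?enorm_ge0// ltW.
have p0 : 0 < \prod_(i < n) (1 + (a * v 0 i) ^+ 2).
  by apply: prodr_gt0 => i _; exact: cauchy_den_gt0.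
rewrite prodfV ler_pdivlMr// (le_trans _ (HC r r0))//.
rewrite -mulrA mulrCA ler_wpM2l ?expR_ge0// [leRHS]exprS ler_wpM2l ?addr_ge0 ?sqr_ge0//.
rewrite -[n in leRHS]card_ord -prodr_const; apply: ler_prod => i _.
rewrite ltW ?cauchy_den_gt0//= lerD2l /r !exprMn ler_wpM2l ?sqr_ge0//.
by rewrite -ler_sqrt ?sqr_ge0// !sqrtr_sqr (ger0_norm (enorm_ge0 _)) ler_coord_enorm.
Qed.

Lemma integrable_prod_cauchy (a : R) : 0 < a ->
  leb.-integrable setT (fun v => (\prod_(i < n) cauchy_weight a (v 0 i))%:E).
Proof.
move=> a0; apply: integrable_prod_rV (integral_cauchy_weight a0).
- exact: continuous_measurable_fun (@continuous_cauchy_weight R a).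
- by move=> s; exact: cauchy_weight_ge0.
Qed.

Lemma measurable_stable_char (theta t : R) : 0 < theta <= 2 -> 0 <= t ->
  measurable_fun setT (@stable_char R n theta t).
Proof. by move=> th t0; exact: posdef_measurable (posdef_stable_char n th t0). Qed.

Lemma integrable_stable_char (theta t : R) : 0 < theta <= 2 -> 0 < t ->
  leb.-integrable setT (fun v => (stable_char theta t v)%:E).
Proof.
move=> th t0; have /andP[th0 th2] := th.
have [C C0 HC] := stable_char_le th0.
have a0 : 0 < t `^ theta^-1 by rewrite powR_gt0.
have ta : t = (t `^ theta^-1) `^ theta by rewrite -powRrM mulVf ?gt_eqF// powRr1// ltW.
apply: (le_integrable measurableT _ _ (integrableZl measurableT C (integrable_prod_cauchy a0))).
  by apply/measurable_EFinP; exact: measurable_stable_char th (ltW t0).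
move=> v _; rewrite lee_fin ger0_norm ?expR_ge0//.
rewrite (le_trans _ (ler_norm _))// (le_trans _ (HC _ v a0))// -ta.
by rewrite ler_peMl ?expR_ge0// lerDl sqr_ge0.
Qed.

Lemma integrable_cos_stable_char (theta t : R) (x : rV) : 0 < theta <= 2 -> 0 < t ->
  leb.-integrable setT (fun v => (cos (dotv x v) * stable_char theta t v)%:E).
Proof.
move=> th t0.
apply: (le_integrable measurableT _ _ (integrable_stable_char th t0)).
  apply/measurable_EFinP/measurable_funM.
    by apply: (measurable_comp _ _ measurable_cos) => //; exact: measurable_dotv.
  exact: measurable_stable_char th (ltW t0).
by move=> v _; rewrite lee_fin normrM ler_piMl ?cos_max.
Qed.

Lemma cvg_tri (s : R) : tri k.+1%:R s @[k --> \oo] --> (1 : R).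
Proof.
have ch : (fun k : nat => (k.+1%:R : R)^-1) @ \oo --> (0 : R) := @cvg_harmonic R.
apply: (@squeeze_cvgr _ _ _ _ (fun k : nat => 1 - `|s| * k.+1%:R^-1) (fun=> 1)).
- by apply: nearW => k; rewrite tri_le1// andbT /tri le_max lexx orbT.
- have : 1 - `|s| * k.+1%:R^-1 @[k --> \oo] --> 1 - `|s| * 0.
    apply: cvgB; first exact: cvg_cst.
    by apply: cvgM => //; exact: cvg_cst.
  by rewrite mulr0 subr0.
- exact: cvg_cst.
Qed.

(** As their width grows, the triangular weights tend to 1, and dominated convergence carries the
    sign over from [posdef_integral_ge0]. *)
Theorem heat_kernel_ge0 (theta t : R) (x : rV) : 0 < theta <= 2 -> 0 < t ->
  0 <= heat_kernel theta x t.
Proof.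
move=> th t0; rewrite heat_kernelE mulr_ge0//.
  by rewrite invr_ge0 exprn_ge0// mulr_ge0// pi_ge0.
rewrite fine_ge0//.
have pE : posdef (fun v : rV => cos (dotv x v) * stable_char theta t v).
  apply: posdef_mul; first exact: posdef_cos.
  by apply: posdef_stable_char => //; exact: ltW.
have k0 k : (0 : R) < k.+1%:R by [].
have p01 k (v : rV) : 0 <= \prod_(i < n) tri k.+1%:R (v 0 i) <= 1.
  rewrite prodr_ge0 => [|i _]; last exact: tri_ge0.
  by rewrite /= prodr_ile1// => i; rewrite tri_ge0 tri_le1.
have mF k : measurable_fun setT (fun v : rV =>
    (cos (dotv x v) * stable_char theta t v * \prod_(i < n) tri k.+1%:R (v 0 i))%:E).
  apply/measurable_EFinP/measurable_funM; first exact: posdef_measurable.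
  exact: measurable_prod_rV (measurable_tri _).
have cF (v : rV) : setT v -> (cos (dotv x v) * stable_char theta t v *
    \prod_(i < n) tri k.+1%:R (v 0 i))%:E @[k --> \oo] -->
    (cos (dotv x v) * stable_char theta t v)%:E.
  move=> _; apply: cvg_EFin; first exact: nearW.
  rewrite -[X in _ --> X]mulr1; apply: cvgM; first exact: cvg_cst.
  have : forall s : seq 'I_n, \prod_(i <- s) tri k.+1%:R (v 0 i) @[k --> \oo] --> (1 : R).
    elim=> [|i s ih]; first by under eq_cvg do rewrite big_nil; exact: cvg_cst.
    have -> : (fun k : nat => \prod_(j <- i :: s) tri (k.+1%:R : R) (v 0 j)) =
        (fun k => tri k.+1%:R (v 0 i) * \prod_(j <- s) tri k.+1%:R (v 0 j)).
      by apply/funext => k; rewrite big_cons.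
    have := cvgM (cvg_tri (v 0 i)) ih; rewrite [1 * 1]mulr1; exact.
  exact.
have bF (v : rV) k : setT v -> (`|(cos (dotv x v) * stable_char theta t v *
    \prod_(i < n) tri k.+1%:R (v 0 i))%:E| <= (stable_char theta t v)%:E)%E.
  move=> _; rewrite lee_fin !normrM; have /andP[q0 q1] := p01 k v.
  rewrite (ger0_norm q0) (ger0_norm (expR_ge0 _)) (le_trans (ler_piMr _ q1))//.
  by rewrite ler_piMl ?expR_ge0 ?cos_max.
have [_ _ cv] := dominated_convergence measurableT mF
  (measurable_int _ (integrable_cos_stable_char x th t0))
  (aeW _ cF) (integrable_stable_char th t0) (aeW _ bF).
rewrite -(cvg_lim _ cv)//; apply: lime_ge; first by apply/cvg_ex; eexists; exact: cv.
by apply: nearW => k; exact: posdef_integral_ge0 (k0 k) pE.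
Qed.

Lemma cos_ge (s : R) : 1 - s ^+ 2 / 2 <= cos s.
Proof.
have -> : cos s = 1 - 2 * sin (s / 2) ^+ 2.
  have -> : s = s / 2 + s / 2 by field.
  rewrite cosD -!expr2 cos2sin2.
  have -> : (s / 2 + s / 2) / 2 = s / 2 by field.
  by ring.
rewrite lerD2l lerN2 -real_normK ?num_real//.
have -> : s ^+ 2 / 2 = 2 * `|s / 2| ^+ 2 by rewrite real_normK ?num_real//; field.
by rewrite ler_pM2l// lerXn2r ?nnegrE// normr_sin_le.
Qed.

Lemma dotv_le (x v : rV) (rho : R) : (forall i, `|x 0 i| <= rho) ->
  `|dotv x v| <= n%:R * (rho * enorm v).
Proof.
move=> xr; rewrite (le_trans (ler_norm_sum _ _ _))//.
have -> : n%:R * (rho * enorm v) = \sum_(i < n) rho * enorm v.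
  by rewrite sumr_const card_ord mulr_natl.
apply: ler_sum => i _.
by rewrite normrM ler_pM// ler_coord_enorm.
Qed.

Definition box (lo hi : rV) : set rV := [set v | forall i, lo 0 i <= v 0 i <= hi 0 i].

Lemma measurable_box lo hi : measurable (box lo hi).
Proof.
rewrite [X in measurable X](_ : _ = \bigcap_(i in [set: 'I_n])
    (fun v : rV => v 0 i) @^-1` `[lo 0 i, hi 0 i]).
  apply: fin_bigcap_measurable => // i _; rewrite -[X in measurable X]setTI.
  exact: measurable_coord_rV.
apply/seteqP; split=> v h i /=; first by move=> _; rewrite in_itv/=; exact: h.
by have := h i I; rewrite /= in_itv.
Qed.

Theorem heat_kernel_ge (theta : R) : 0 < theta <= 2 ->
  exists c kappa : R, [/\ 0 < c, 0 < kappa & forall (a : R) (x : rV), 0 < a ->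
    (forall i, `|x 0 i| <= kappa * a) -> c / a ^+ n <= heat_kernel theta x (a `^ theta)].
Proof.
move=> th; have /andP[th0 _] := th.
have [C C0 HC] := stable_char_le th0.
(* On the cube of radius 1 / a one has a |v| <= sqrt n <= n, so the stable characteristic function
   is at least [e0] there. *)
pose e0 : R := expR (- n%:R `^ theta).
have e00 : 0 < e0 := expR_gt0 _.
have pi0 : 0 < pi :> R := pi_gt0 R.
(* The loss from cos s >= 1 - s^2 / 2 is at most kappa^2 d / (2 a^n), and [kappa] is such that this
   is at most half of the main term e0 (2 / a)^n. The 1 in [d + 1] covers d = 0, which occurs for n
   = 0. *)
pose d : R := n%:R ^+ 2 * C * pi ^+ n.
have d0 : 0 <= d by rewrite !mulr_ge0 ?sqr_ge0 ?exprn_ge0 ?(ltW C0) ?(ltW pi0).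
have d1 : 0 < d + 1 by rewrite ltr_wpDl.
have k20 : 0 < e0 * 2 ^+ n / (d + 1) by rewrite divr_gt0// mulr_gt0// exprn_gt0.
pose kappa := Num.sqrt (e0 * 2 ^+ n / (d + 1)).
have kk : kappa ^+ 2 = e0 * 2 ^+ n / (d + 1) by rewrite sqr_sqrtr// ltW.
have kd : kappa ^+ 2 * d <= e0 * 2 ^+ n.
  rewrite kk mulrAC ler_pdivrMr// ler_wpM2l ?lerDl// mulr_ge0 ?exprn_ge0// ltW//.
exists ((2 * pi) ^- n * (e0 * 2 ^+ n / 2)), kappa; split.
- by rewrite mulr_gt0 ?invr_gt0 ?exprn_gt0 ?divr_gt0 ?mulr_gt0 ?exprn_gt0.
- by rewrite sqrtr_gt0.
move=> a x a0 xk.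
have t0 : 0 < a `^ theta by rewrite powR_gt0.
have aN0 : 0 < a ^+ n by rewrite exprn_gt0.
rewrite heat_kernelE -[leLHS]mulrA ler_wpM2l ?invr_ge0 ?exprn_ge0 ?mulr_ge0 ?(ltW pi0)//.
have icE := integrable_cos_stable_char x th t0.
rewrite -lee_fin fineK; last exact: integrable_fin_num.
pose B := box (const_mx (- a^-1)) (const_mx a^-1).
have mB : measurable B by exact: measurable_box.
have muB : leb B = ((2 / a) ^+ n)%:E.
  rewrite [LHS]lebesgue_rV_box => [|i]; last by rewrite !mxE ge0_cp ?invr_ge0// ltW.
  rewrite (eq_bigr (fun=> 2 / a)) => [|i _]; first by rewrite prodr_const card_ord.
  by rewrite !mxE opprK mulr_natl mulr2n.
have intB : (\int[leb]_v (\1_B v)%:E = ((2 / a) ^+ n)%:E)%E.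
  by rewrite integral_indic// setIT; exact: muB.
have iB : leb.-integrable setT (fun v => (\1_B v)%:E).
  apply/integrableP; split; first exact/measurable_EFinP/measurable_indic.
  under eq_integral do rewrite gee0_abs ?lee_fin//.
  by rewrite intB ltry.
have i1 : leb.-integrable setT (fun v => (e0 * \1_B v)%:E).
  by under eq_fun do rewrite EFinM; exact: integrableZl.
pose c2 := kappa ^+ 2 * n%:R ^+ 2 * C / 2.
have i2 : leb.-integrable setT (fun v => (c2 * \prod_(i < n) cauchy_weight a (v 0 i))%:E).
  under eq_fun do rewrite EFinM.
  exact: integrableZl (integrable_prod_cauchy a0).
apply: (le_trans _ (le_integral measurableT (integrableB measurableT i1 i2) icE _)); last first.
  move=> v _; rewrite -EFinB lee_fin.
  set E := stable_char _ _ _; have E0 : 0 <= E := expR_ge0 _.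
  rewrite (@le_trans _ _ ((1 - dotv x v ^+ 2 / 2) * E))//; last by rewrite ler_wpM2r ?cos_ge.
  rewrite mulrBl mul1r; apply: lerB.
    rewrite indicE; case: (boolP (v \in B)) => [/set_mem vB|_]; last by rewrite mulr0.
    rewrite mulr1 ler_expR lerN2 -powRM ?enorm_ge0 ?(ltW a0)//.
    rewrite ge0_ler_powR ?nnegrE ?mulr_ge0 ?enorm_ge0 ?(ltW a0) ?(ltW th0)//.
    rewrite -(@ler_pXn2r _ 2) ?nnegrE ?mulr_ge0 ?enorm_ge0 ?(ltW a0)//.
    rewrite exprMn enorm_sqr mulr_sumr.
    apply: (@le_trans _ _ (\sum_(i < n) 1)).
      apply: ler_sum => i _; have := vB i; rewrite !mxE -ler_norml => vi.
      rewrite -exprMn -real_normK ?num_real// expr_le1// normrM (gtr0_norm a0).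
      by rewrite -ler_pdivlMl// mulr1.
    rewrite sumr_const card_ord -natrX ler_nat; case: (n) => // k.
    by rewrite expnS expn1 leq_pmulr.
  have -> : c2 * \prod_(i < n) cauchy_weight a (v 0 i) =
      kappa ^+ 2 * n%:R ^+ 2 / 2 * (C * \prod_(i < n) cauchy_weight a (v 0 i)).
    by rewrite /c2; ring.
  apply: le_trans (ler_wpM2l _ (HC a v a0)); last first.
    by rewrite divr_ge0// mulr_ge0 ?sqr_ge0.
  rewrite -/E mulrA ler_wpM2r//.
  rewrite (@le_trans _ _ (kappa ^+ 2 * n%:R ^+ 2 / 2 * (a * enorm v) ^+ 2))//; last first.
    by rewrite ler_wpM2l ?lerDr// divr_ge0// mulr_ge0 ?sqr_ge0.
  have -> : kappa ^+ 2 * n%:R ^+ 2 / 2 * (a * enorm v) ^+ 2 =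
      (n%:R * (kappa * a * enorm v)) ^+ 2 / 2 by ring.
  rewrite ler_pM2r ?invr_gt0// -[leLHS]real_normK ?num_real//.
  rewrite lerXn2r ?nnegrE ?dotv_le// !mulr_ge0 ?sqrtr_ge0 ?enorm_ge0// ltW//.
rewrite integralB_EFin//.
under eq_integral do rewrite EFinM.
rewrite integralZl//.
rewrite intB.
under [X in (_ - X)%E]eq_integral do rewrite EFinM.
rewrite integralZl//; last exact: integrable_prod_cauchy.
rewrite (@ge0_integral_prod_rV _ _ _ (pi / a)); last 3 first.
- exact: continuous_measurable_fun (@continuous_cauchy_weight R a).
- by move=> s; exact: cauchy_weight_ge0.
- exact: integral_cauchy_weight.
rewrite -!EFinM -EFinB lee_fin !exprMn !exprVn /c2.
have -> : e0 * (2 ^+ n / a ^+ n) - kappa ^+ 2 * n%:R ^+ 2 * C / 2 * (pi ^+ n / a ^+ n) =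
   (e0 * 2 ^+ n - kappa ^+ 2 * d / 2) / a ^+ n by rewrite /d; ring.
rewrite ler_wpM2r ?invr_ge0 ?(ltW aN0)//.
by move: kd; lra.
Qed.

End heat_kernel_lower_bound.
(** * The estimate on small cubes *)

(* With y_j = e * b_j `^ q the recursion gives 1 / y_j - 1 / y_(j+1) >= const
   as long as y_j stays bounded. *)
Lemma recursion_bound (R : realType) (q M : R) : 0 < q -> 0 < M ->
  exists2 D : R, 0 < D & forall (e : R) (b : nat -> R) (J : nat), 0 < e ->
    (forall j, 0 < b j) -> (forall j, b j.+1 = b j * (1 + e * b j `^ q)) ->
    (forall j, (j <= J)%N -> e * b j `^ q <= M) ->
    e * b 0%N `^ q * J.+1%:R <= D.
Proof.
move=> q0 M0.
have M1 : 0 < 1 + M by rewrite addr_gt0.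
(* A slope with (1 + y)^q >= 1 + c y for 0 < y <= M, obtained from ln (1 + y) >= y / (1 + y). *)
pose c := q / (1 + M); have c0 : 0 < c by rewrite divr_gt0.
have cM1 : 0 < 1 + c * M by rewrite addr_gt0// mulr_gt0.
(* As 1 / (y (1 + c y)) = 1 / y - c / (1 + c y), each step lowers 1 / y by at least the first entry.
   The second one lets 1 / y_J >= 1 / M count as a further step, whence [J.+1]. *)
pose d := Num.min (c / (1 + c * M)) M^-1.
have d0 : 0 < d by rewrite lt_min invr_gt0 M0 andbT divr_gt0.
exists d^-1 => [|e b J e0 b0 bS bM]; first by rewrite invr_gt0.
pose y j := e * b j `^ q.
have y0 j : 0 < y j by rewrite mulr_gt0// powR_gt0.
have key j : (j < J)%N -> (y j.+1)^-1 + d <= (y j)^-1.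
  move=> jJ; have yM : y j <= M := bM _ (ltnW jJ).
  have y1 : 0 < 1 + y j by rewrite addr_gt0.
  have yS : y j * (1 + c * y j) <= y j.+1.
    rewrite /y bS powRM ?(ltW (b0 _)) ?addr_ge0 ?mulr_ge0 ?powR_ge0 ?(ltW e0)//.
    have -> : e * (b j `^ q * (1 + e * b j `^ q) `^ q) = y j * (1 + y j) `^ q by rewrite mulrA.
    rewrite ler_wpM2l ?(ltW (y0 _))//.
    have -> : (1 + y j) `^ q = expR (q * ln (1 + y j)) by rewrite {1}/powR gt_eqF.
    apply: (le_trans _ (expR_ge1Dx _)).
    rewrite lerD2l /c mulrAC -mulrA ler_wpM2l ?(ltW q0)//.
    have : ln (1 + y j)^-1 <= (1 + y j)^-1 - 1.
      have := @le_ln1Dx _ ((1 + y j)^-1 - 1); rewrite addrCA subrr addr0; apply.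
      by rewrite ltrBrDr addNr invr_gt0.
    rewrite lnV ?posrE// => h.
    have h' : y j / (1 + y j) <= ln (1 + y j).
      have -> : y j / (1 + y j) = - ((1 + y j)^-1 - 1) by field; rewrite gt_eqF.
      by rewrite lerNl.
    apply: le_trans h'; rewrite ler_wpM2l ?(ltW (y0 _))//.
    by rewrite lef_pV2 ?posrE// lerD2l.
  have cy1 : 0 < 1 + c * y j by rewrite addr_gt0// mulr_gt0.
  have : (y j.+1)^-1 <= (y j * (1 + c * y j))^-1.
    by rewrite lef_pV2// posrE ?y0// (mulr_gt0 (y0 j)).
  have -> : (y j * (1 + c * y j))^-1 = (y j)^-1 - c / (1 + c * y j).
    by field; rewrite !gt_eqF.
  suff dc : d <= c / (1 + c * y j) by move=> yj; move: (lerD yj dc); rewrite subrK.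
  apply: (@le_trans _ _ (c / (1 + c * M))); first by rewrite /d ge_min lexx.
  by rewrite ler_wpM2l ?(ltW c0)// lef_pV2 ?posrE// lerD2l ler_wpM2l// ltW.
have tele j : (j <= J)%N -> j%:R * d + (y j)^-1 <= (y 0%N)^-1.
  elim: j => [_|j ih jJ]; first by rewrite mul0r add0r.
  apply: le_trans (ih (ltnW jJ)); rewrite -natr1 mulrDl mul1r -addrA lerD2l.
  by rewrite addrC key.
have -> : e * b 0%N `^ q = y 0%N by [].
rewrite -[d^-1]mul1r ler_pdivlMr// -mulrA -ler_pdivlMl// mulr1.
apply: le_trans (tele J (leqnn J)); rewrite -natr1 mulrDl mul1r lerD2l.
apply: (@le_trans _ _ M^-1); first by rewrite /d ge_min lexx orbT.
by rewrite lef_pV2 ?posrE// bM.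
Qed.

(** * Lower bounds of integrals, and null sets in products *)

Section lower_integral.
Local Open Scope ereal_scope.
Context d (T : measurableType d) (R : realType) (mu : {measure set T -> \bar R}).

(* The integral of a nonnegative function is a supremum over simple functions
   below it: the larger function need not be measurable. *)
Lemma ae_ge0_le_lower_integral (D : set T) (g f : T -> \bar R) : measurable D ->
  measurable_fun D g -> (forall x, D x -> 0 <= g x) -> (forall x, D x -> 0 <= f x) ->
  {ae mu, forall x, D x -> g x <= f x} ->
  \int[mu]_(x in D) g x <= \int[mu]_(x in D) f x.
Proof.
move=> mD mg g0 f0 [N [mN muN gfN]].
rewrite (ge0_negligible_integral mN mD mg g0 muN).
rewrite !ge0_integralE//; last by move=> x [/g0].
apply: ereal_sup_le => _ [h /= hg <-]; exists h => // x.
apply: le_trans (hg x) _; rewrite !patchE.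
case: ifPn => [/set_mem[Dx Nx]|_].
  rewrite mem_set//; case: (pselect (g x <= f x)) => // gf.
  by exfalso; apply/Nx/gfN => /(_ Dx).
by case: ifPn => // /set_mem /f0.
Qed.

Lemma ge0_lower_integral_indic (A D : set T) (f : T -> \bar R) (k : R) :
  measurable D -> measurable A -> A `<=` D -> (0 <= k)%R ->
  (forall x, D x -> 0 <= f x) -> {ae mu, forall x, A x -> k%:E <= f x} ->
  k%:E * mu A <= \int[mu]_(x in D) f x.
Proof.
move=> mD mA AD k0 f0 kf.
have -> : k%:E * mu A = \int[mu]_(x in D) (k%:E * (\1_A x)%:E).
  rewrite ge0_integralZl_EFin//; last exact/measurable_EFinP/measurable_indic.
  by rewrite integral_indic// setIidl.
apply: ae_ge0_le_lower_integral => //.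
- by apply: emeasurable_funM => //; exact/measurable_EFinP/measurable_indic.
- by move=> x _; rewrite mule_ge0 ?lee_fin.
- apply: filterS kf => x kf Dx; rewrite indicE.
  case: (boolP (x \in A)) => [/set_mem Ax|_]; last by rewrite mule0 f0.
  by rewrite mule1 kf.
Qed.

End lower_integral.

Section ae_product.
Local Open Scope ereal_scope.
Context d1 d2 (T1 : measurableType d1) (T2 : measurableType d2) (R : realType)
  (m1 : {sigma_finite_measure set T1 -> \bar R})
  (m2 : {sigma_finite_measure set T2 -> \bar R}).

(** Tonelli is applied to the indicator of a measurable null set enclosing the exceptional set,
    which may itself fail to be measurable. *)
Lemma ae_prod_sections (P : T1 -> T2 -> Prop) :
  {ae m1 \x m2, forall z, P z.1 z.2} ->
  {ae m2, forall y, {ae m1, forall x, P x y}}.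
Proof.
move=> [N [mN muN PN]].
have mf : measurable_fun setT (fun z : T1 * T2 => (\1_N z : R)%:E).
  exact/measurable_EFinP/measurable_indic.
have f0 z : 0 <= (\1_N z : R)%:E by rewrite lee_fin.
have := fubini_tonelli2 (m1 := m1) (m2 := m2) _ mf f0.
rewrite integral_indic// setIT [X in X = _](_ : _ = 0)//.
pose G y := \int[m1]_x (\1_N (x, y) : R)%:E.
have G0 y : 0 <= G y by apply: integral_ge0.
have mG : measurable_fun setT G := measurable_fun_fubini_tonelli_G _ mf f0.
move=> /esym/= iG.
have : \int[m2]_y `|G y| = 0.
  by rewrite -[RHS]iG; apply: eq_integral => y _; rewrite gee0_abs.
move=> /(ae_eq_integral_abs m2 measurableT mG); apply: filterS => y /(_ I) Gy.
exists (ysection N y); split; first exact: measurable_ysection.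
  have := Gy; rewrite /G.
  under eq_integral.
    move=> x _; rewrite (_ : \1_N (x, y) = \1_(ysection N y) x); last first.
      by rewrite !indicE mem_ysection.
    over.
  by rewrite integral_indic ?setIT//; exact: measurable_ysection.
by move=> x /= nP; rewrite /ysection/= inE; exact: PN.
Qed.

End ae_product.

(** * Lower bounds of the two terms of Duhamel's formula *)

Section duhamel_lower_bounds.
Context {R : realType} {n : nat}.
Local Notation rV := 'rV[R]_n.
Local Notation leb := (@lebesgue_rV R n).
Local Notation leb1 := (@lebesgue_measure R : {measure set (measurableTypeR R) -> \bar R}).

(** Sup-norm balls are used because [lebesgue_rV_box] gives their volume exactly. *)
Definition cube (w : rV) (r : R) : set rV := box (w - const_mx r) (w + const_mx r).

Lemma cubeP (w v : rV) r : cube w r v <-> forall i, `|v 0 i - w 0 i| <= r.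
Proof.
by split=> h i; have := h i; rewrite !mxE ler_distl.
Qed.

Lemma lebesgue_rV_box_cst (lo hi : rV) (s : R) : 0 <= s ->
  (forall i, hi 0 i - lo 0 i = s) -> leb (box lo hi) = (s ^+ n)%:E.
Proof.
move=> s0 hs; rewrite [LHS]lebesgue_rV_box => [|i]; last by rewrite -subr_ge0 hs.
by rewrite (eq_bigr _ (fun i _ => hs i)) prodr_const card_ord.
Qed.

Lemma lebesgue_rV_cube (w : rV) r : 0 <= r -> leb (cube w r) = ((2 * r) ^+ n)%:E.
Proof.
move=> r0; apply: lebesgue_rV_box_cst => [|i]; first by rewrite mulr_ge0.
by rewrite !mxE; ring.
Qed.

(** The power |y|^(-gamma) has the default value 0 at y = 0, so the bound by K^(-gamma) in
    [source_ge] fails there and the origin must be removed. *)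
Lemma ae_neq0_rV : (0 < n)%N -> {ae leb, forall v : rV, v != 0}.
Proof.
move=> n0; exists (box 0 0); split; first exact: measurable_box.
  by rewrite (lebesgue_rV_box_cst (lexx 0)) ?expr0n ?gtn_eqF// => i; rewrite subrr.
by move=> v /= /negP; rewrite negbK => /eqP -> i; rewrite lexx.
Qed.

Lemma enorm_le_coord (v : rV) (B : R) : 0 <= B -> (forall i, `|v 0 i| <= B) ->
  enorm v <= n%:R * B.
Proof.
move=> B0 vB; rewrite -(@ler_pXn2r _ 2) ?nnegrE ?enorm_ge0 ?mulr_ge0// enorm_sqr.
apply: (@le_trans _ _ (\sum_(i < n) B ^+ 2)).
  by apply: ler_sum => i _; rewrite -real_normK ?num_real// lerXn2r ?nnegrE.
rewrite sumr_const card_ord -[leLHS]mulr_natl exprMn ler_wpM2r ?sqr_ge0// -natrX ler_nat.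
by case: (n) => // m; rewrite expnS expn1 leq_pmulr.
Qed.

Variables (theta gamma p : R) (mu : {measure set rV -> \bar R}) (u : rV -> R -> \bar R).
Hypothesis th : 0 < theta <= 2.
Hypothesis n0 : (0 < n)%N.
Hypothesis g0 : 0 < gamma.
Hypothesis p0 : 0 < p.

Definition source (x : rV) (t s : R) : \bar R :=
  (\int[leb]_y ((heat_kernel theta (x - y) (t - s))%:E
      * (enorm y `^ (- gamma))%:E * u y s `^ p))%E.

Lemma source_integrand_ge0 (x y : rV) (t s : R) : s < t ->
  (0 <= (heat_kernel theta (x - y)%R (t - s)%R)%:E
      * (enorm y `^ (- gamma))%R%:E * u y s `^ p)%E.
Proof.
move=> st; rewrite !mule_ge0 ?poweR_ge0// lee_fin ?powR_ge0//.
by rewrite heat_kernel_ge0// subr_gt0.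
Qed.

Lemma source_ge0 x t s : s < t -> (0 <= source x t s)%E.
Proof. by move=> st; apply: integral_ge0 => y _; exact: source_integrand_ge0. Qed.

Lemma source_ge (x : rV) (t s g K b V : R) (P : set rV) : s < t ->
  measurable P -> leb P = V%:E -> 0 <= g -> 0 < K -> 0 <= b ->
  (forall y, P y -> g <= heat_kernel theta (x - y) (t - s)) ->
  (forall y, P y -> enorm y <= K) ->
  {ae leb, forall y, P y -> (b%:E <= u y s)%E} ->
  ((g * K `^ (- gamma) * b `^ p * V)%:E <= source x t s)%E.
Proof.
move=> st mP PV g_ge0 K0 b0 gG yK bu.
rewrite EFinM -PV; apply: ge0_lower_integral_indic => //.
- by rewrite !mulr_ge0 ?powR_ge0.
- by move=> y _; exact: source_integrand_ge0.
have ny0 := ae_neq0_rV n0.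
apply: (filterS2 _ _ bu ny0) => y bu' y0 Py.
have eN0 : 0 < enorm y.
  rewrite lt_neqAle enorm_ge0 andbT eq_sym; apply: contra y0 => /eqP ey.
  apply/eqP/rowP => i; rewrite mxE; apply/eqP; rewrite -normr_le0 -ey.
  exact: ler_coord_enorm.
rewrite !EFinM; apply: lee_pmul.
- by rewrite -EFinM lee_fin mulr_ge0 ?powR_ge0.
- by rewrite lee_fin powR_ge0.
- apply: lee_pmul; rewrite ?lee_fin ?powR_ge0 ?gG//.
  rewrite !powRN lef_pV2 ?posrE ?powR_gt0// ge0_ler_powR ?nnegrE ?yK// ltW//.
- rewrite -poweR_EFin gt0_ler_poweR ?(ltW p0) ?bu'//.
  by rewrite in_itv/= lee_fin b0 leey.
  by rewrite in_itv/= leey andbT (le_trans _ (bu' Py))// lee_fin.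
Qed.

(** The time intervals are disjoint, so a single step function in [s] lies below the source; no
    measurability of [source x t] is asked for. *)
Lemma duhamel_ge (x : rV) (t k : R) (A : set rV) (m : nat) (l r w : nat -> R) :
  0 < t -> measurable A -> 0 <= k ->
  (forall y, A y -> k <= heat_kernel theta (x - y) t) ->
  (forall i, (i < m)%N -> [/\ 0 <= l i, l i <= r i, r i <= t & 0 <= w i]) ->
  (forall i j s, (i < m)%N -> (j < m)%N -> l i < s < r i -> l j < s < r j -> i = j) ->
  {ae leb1, forall s, forall i, (i < m)%N -> l i < s < r i ->
     ((w i)%:E <= source x t s)%E} ->
  (k%:E * mu A + (\sum_(i < m) w i * (r i - l i))%:E <= duhamel theta gamma p mu u x t)%E.
Proof.
move=> t0 mA k0 kG lrw tri wF; rewrite /duhamel leeD//.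
  apply: ge0_lower_integral_indic => //; last exact: aeW.
  by move=> y _; rewrite lee_fin heat_kernel_ge0.
pose g (s : R) : R := \sum_(i < m) w i * \1_(`]l i, r i[%classic) s.
have w0 (i : 'I_m) : 0 <= w i by have [] := lrw i (ltn_ord i).
have <- : (\int[lebesgue_measure]_(s in `]0%R, t[) (g s)%:E =
    (\sum_(i < m) w i * (r i - l i))%:E)%E.
  under eq_integral do rewrite /g -sumEFin.
  rewrite ge0_integral_sum//; last 2 first.
  - move=> i; apply/measurable_EFinP/measurable_funM => //.
  - by move=> i s _; rewrite lee_fin mulr_ge0.
  rewrite -sumEFin; apply: eq_bigr => i _.
  under eq_integral do rewrite EFinM.
  rewrite ge0_integralZl_EFin//; last exact/measurable_EFinP/measurable_indic.
  rewrite integral_indic// EFinM; congr (_ * _)%E.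
  have [l0 lr rt _] := lrw i (ltn_ord i).
  rewrite setIidl; last first.
    move=> s /=; rewrite !in_itv/= => /andP[ls sr].
    by rewrite (le_lt_trans l0)//= (lt_le_trans sr).
  apply: etrans (lebesgue_measure_itv _) _; rewrite /= lte_fin.
  by case: ltgtP lr => // -> _; rewrite subrr.
apply: ae_ge0_le_lower_integral => //.
- apply/measurable_EFinP/measurable_sum => i; exact: measurable_funM.
- by move=> s _; rewrite lee_fin sumr_ge0// => i _; rewrite mulr_ge0.
- by move=> s /=; rewrite in_itv/= => /andP[_ st]; exact: source_ge0.
- apply: (@filterS _ _ (ae_filter_ringOfSetsType leb1) _ _ _ wF) => s ws.
  rewrite /= in_itv/= => /andP[_ st].
  have [[i is_]|ni] := pselect (exists i : 'I_m, l i < s < r i).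
    rewrite /g (bigD1 i)//= big1 ?addr0 => [|j ji].
      by rewrite indicE mem_set ?mulr1 ?ws//= in_itv.
    rewrite indicE memNset ?mulr0//= in_itv/= => js.
    have /val_inj ij := tri _ _ s (ltn_ord j) (ltn_ord i) js is_.
    by rewrite ij eqxx in ji.
  rewrite /g big1 ?source_ge0// => i _.
  by rewrite indicE memNset ?mulr0//= in_itv/= => is_; apply: ni; exists i.
Qed.

End duhamel_lower_bounds.

(** * Propagation of lower bounds on cubes *)

Section iteration.
Context {R : realType} {n : nat}.
Local Notation rV := 'rV[R]_n.
Local Notation leb := (@lebesgue_rV R n).
Local Notation leb1 := (@lebesgue_measure R : {measure set (measurableTypeR R) -> \bar R}).

Variables (theta gamma p T : R) (mu : {measure set rV -> \bar R}) (u : rV -> R -> \bar R).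
Hypothesis th : 0 < theta <= 2.
Hypothesis n0 : (0 < n)%N.
Hypothesis g0 : 0 < gamma.
Hypothesis pE : p = 1 + theta / n%:R.
Hypothesis sol : is_solution theta gamma p mu u T%:E.

Local Notation G := (heat_kernel theta).

Let th0 : 0 < theta. Proof. by have /andP[] := th. Qed.
Let nR0 : 0 < n%:R :> R. Proof. by rewrite ltr0n. Qed.
Let p0 : 0 < p. Proof. by rewrite pE addr_gt0// divr_gt0. Qed.

Lemma solution_sections : {ae leb1, forall t, {ae leb, forall x,
  0 < t < T -> (u x t < +oo)%E /\ u x t = duhamel theta gamma p mu u x t}}.
Proof.
have [_ _ ae_u] := sol.
have : {ae (leb \x @lebesgue_measure R)%E, forall z, 0 < z.2 < T ->
    (u z.1 z.2 < +oo)%E /\ u z.1 z.2 = duhamel theta gamma p mu u z.1 z.2}.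
  apply: (@filterS _ _ (ae_filter_ringOfSetsType lebesgue_space_time) _ _ _ ae_u).
  move=> z zP /andP[z0 zT]; apply: zP.
  by split=> //; rewrite lte_fin.
exact: (@ae_prod_sections _ _ _ _ _ leb (@lebesgue_measure R) (fun x t => 0 < t < T ->
  (u x t < +oo)%E /\ u x t = duhamel theta gamma p mu u x t)).
Qed.

(** The null sets are nested because Duhamel's formula first integrates in y at a fixed time and
    then over time. *)
Definition lowerb (b : R) (Q : set rV) (l r : R) := {ae leb1, forall t, l < t < r ->
  {ae leb, forall x, Q x -> (b%:E <= u x t)%E}}.

Lemma lowerbW b b' Q l r : b' <= b -> lowerb b Q l r -> lowerb b' Q l r.
Proof.
move=> bb'; apply: (@filterS _ _ (ae_filter_ringOfSetsType leb1)) => t h lt.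
by apply: filterS (h lt) => x bu /bu; apply: le_trans; rewrite lee_fin.
Qed.

(** One use of Duhamel's formula, in the form shared by the iteration inside a block and the chain
    of blocks: [A] contributes k m, and each block finished by time [l] contributes [w i] times its
    duration. *)
Lemma lowerb_step (Q A : set rV) (l r k m : R) (nb : nat) (L S b w : nat -> R)
    (Qs : nat -> set rV) :
  0 <= l -> r <= T -> measurable A -> 0 <= k -> (m%:E <= mu A)%E ->
  (forall x t y, Q x -> l < t < r -> A y -> k <= G (x - y) t) ->
  (forall i, (i < nb)%N -> [/\ 0 <= L i, L i <= S i, S i <= l & 0 <= w i]) ->
  (forall i j s, (i < nb)%N -> (j < nb)%N -> L i < s < S i -> L j < s < S j -> i = j) ->
  (forall i, (i < nb)%N -> lowerb (b i) (Qs i) (L i) (S i)) ->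
  (forall i x t s, (i < nb)%N -> Q x -> l < t < r -> L i < s < S i ->
    {ae leb, forall y, Qs i y -> ((b i)%:E <= u y s)%E} ->
    ((w i)%:E <= source theta gamma p u x t s)%E) ->
  lowerb (k * m + \sum_(i < nb) w i * (S i - L i)) Q l r.
Proof.
move=> l0 rT mA k0 mmu kG LSw disj low srcw.
have aeF := ae_filter_ringOfSetsType leb1.
have low' : {ae leb1, forall s i, (i < nb)%N -> L i < s < S i ->
    {ae leb, forall y, Qs i y -> ((b i)%:E <= u y s)%E}}.
  apply: ae_foralln => i; case: (ltnP i nb) => [inb|_]; last exact: aeW.
  by apply: (@filterS _ _ aeF) (low i inb) => s h _ /h.
apply: (@filterS _ _ aeF) solution_sections => t sol_t ltr.
have /andP[lt_ tr] := ltr.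
have t0 : 0 < t by rewrite (le_lt_trans l0).
apply: filterS sol_t => x solx Qx.
have [] := solx; first by rewrite t0 (lt_le_trans tr).
move=> _ ->.
apply: (le_trans _ (duhamel_ge (k := k) (A := A) (m := nb) (l := L) (r := S) (w := w)
  mu th t0 mA k0 _ _ disj _)).
- by rewrite EFinD EFinM leeD// lee_wpmul2l// lee_fin.
- by move=> y Ay; exact: (kG _ _ _ Qx ltr).
- move=> i inb; have [? ? Sl ?] := LSw i inb; split => //.
  by rewrite (le_trans Sl)// ltW.
- apply: (@filterS _ _ aeF) low' => s h i inb Ls.
  exact: (srcw i x t s inb Qx ltr Ls (h i inb Ls)).
Qed.

Variables (c kappa eps K : R).
Hypothesis c0 : 0 < c.
Hypothesis Gc : forall (a : R) (x : rV), 0 < a -> (forall i, `|x 0 i| <= kappa * a) ->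
  c / a ^+ n <= G x (a `^ theta).
Hypothesis eps0 : 0 < eps.
Local Notation r2 := (2 `^ theta^-1 : R).
Hypothesis eps_kappa : 2 * eps * r2 <= kappa.
Hypothesis K0 : 0 < K.
Local Notation h := (K `^ (- gamma)).

Let r20 : 0 < r2. Proof. by rewrite powR_gt0. Qed.
Let r21 : 1 <= r2.
Proof.
apply: (@le_trans _ _ (1 `^ theta^-1)); first by rewrite powR1.
by rewrite ge0_ler_powR ?nnegrE ?invr_ge0 ?ler1n ?(ltW th0).
Qed.
Let r2th : r2 `^ theta = 2.
Proof. by rewrite -powRrM mulVf ?gt_eqF// powRr1. Qed.
Let h0 : 0 < h. Proof. by rewrite powR_gt0. Qed.
Let powR_thK (t : R) : 0 <= t -> (t `^ theta^-1) `^ theta = t.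
Proof. by move=> t0; rewrite -powRrM mulVf ?gt_eqF// powRr1. Qed.
Let ler_powR_th (a b : R) : 0 <= a -> 0 <= b -> (a `^ theta <= b `^ theta) = (a <= b).
Proof.
move=> a0 b0; apply/idP/idP => [|ab].
  apply: contra_le => ba; rewrite gt0_ltr_powR ?nnegrE//.
by rewrite ge0_ler_powR ?nnegrE// ltW.
Qed.

(** [Gc] speaks of the exact scale a = t^(1/theta). Here a and A agree up to the factor [r2], and
    [eps_kappa] is the condition that 2 eps A <= kappa a. *)
Lemma heat_kernel_ge_comparable (A t : R) (x : rV) : 0 < A ->
  A `^ theta / 2 <= t <= 2 * A `^ theta -> (forall i, `|x 0 i| <= 2 * eps * A) ->
  c / r2 ^+ n / A ^+ n <= G x t.
Proof.
move=> A0 /andP[At tA] xA.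
have At0 : 0 < A `^ theta by rewrite powR_gt0.
have t0 : 0 < t by rewrite (lt_le_trans _ At)// divr_gt0.
pose a := t `^ theta^-1.
have a0 : 0 < a by rewrite powR_gt0.
have ath : a `^ theta = t by rewrite powR_thK// ltW.
have aA : a <= r2 * A.
  rewrite -ler_powR_th ?mulr_ge0 ?(ltW a0) ?(ltW A0) ?(ltW r20)// ath.
  by rewrite powRM ?(ltW A0) ?(ltW r20)// r2th.
have Aa : A <= r2 * a.
  rewrite -ler_powR_th ?mulr_ge0 ?(ltW a0) ?(ltW A0) ?(ltW r20)//.
  by rewrite powRM ?(ltW a0) ?(ltW r20)// r2th ath mulrC -ler_pdivrMr.
rewrite -ath (le_trans _ (Gc a0 _))//.
  rewrite -mulrA -invfM -exprMn ler_wpM2l ?(ltW c0)//.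
  rewrite lef_pV2 ?posrE ?exprn_gt0 ?mulr_gt0//.
  by rewrite lerXn2r ?nnegrE ?mulr_ge0 ?(ltW a0) ?(ltW A0) ?(ltW r20).
move=> i; rewrite (le_trans (xA i))//.
rewrite (@le_trans _ _ (2 * eps * (r2 * a)))//.
  by rewrite ler_wpM2l// mulr_ge0// ltW.
by rewrite mulrA ler_wpM2r// ltW.
Qed.

(** This is n p = n + theta; the factor A^(-theta) left over cancels against the duration of a
    block. *)
Lemma powR_scaling (b A : R) : 0 <= b -> 0 < A ->
  (b / A ^+ n) `^ p * A ^+ n = b `^ p / A `^ theta.
Proof.
move=> b0 A0; have An0 : 0 < A ^+ n by rewrite exprn_gt0.
rewrite powRM// ?invr_ge0 ?(ltW An0)//.
have -> : (A ^+ n)^-1 `^ p = (A ^+ n * A `^ theta)^-1.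
  rewrite -powR_mulrn ?(ltW A0)// -powRN -powRrM -powRD ?(gt_eqF A0) ?implybT//.
  by rewrite -powRN; congr (_ `^ _); rewrite pE; field; rewrite gt_eqF.
by field; rewrite !gt_eqF// powR_gt0.
Qed.

(* For y in a box of side eps (t - s)^(1/theta) with a corner at x and contained in
   the cube, the kernel times the volume of the box is bounded below. *)
Lemma source_ge_corner (x w : rV) (s t b A : R) : 0 <= b -> 0 < A ->
  0 < t - s <= A `^ theta -> cube w (eps * A) x ->
  (forall y, cube w (eps * A) y -> enorm y <= K) ->
  {ae leb, forall y, cube w (eps * A) y -> (b%:E <= u y s)%E} ->
  ((c * eps ^+ n * h * b `^ p)%:E <= source theta gamma p u x t s)%E.
Proof.
move=> b0 A0 /andP[ts0 tsA] Qx yK bu.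
pose a := (t - s) `^ theta^-1.
have a0 : 0 < a by rewrite powR_gt0.
have ath : a `^ theta = t - s by rewrite powR_thK// ltW.
have aA : a <= A by rewrite -ler_powR_th ?(ltW a0) ?(ltW A0)// ath.
have ea0 : 0 < eps * a by rewrite mulr_gt0.
have eaA : eps * a <= eps * A by rewrite ler_wpM2l// ltW.
(* In each coordinate the box extends from [x] towards the centre [w], so it stays in the cube. Its
   volume (eps a)^n cancels the singularity a^(-n) of the kernel as s tends to t. *)
pose lo : rV := \row_i (if x 0 i <= w 0 i then x 0 i else x 0 i - eps * a).
pose P := box lo (lo + const_mx (eps * a)).
have Px y i : P y -> `|x 0 i - y 0 i| <= eps * a.
  move=> /(_ i); rewrite !mxE; case: ifP => _ /andP[y1 y2]; rewrite ler_norml.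
    by apply/andP; split; move: y1 y2; lra.
  by apply/andP; split; move: y1 y2; lra.
have PQ y : P y -> cube w (eps * A) y.
  move=> Py; apply/cubeP => i; have /cubeP/(_ i) := Qx; have := Py i.
  rewrite !mxE !ler_norml; case: ifPn => [xw|]; last rewrite -ltNge => xw.
    by move=> /andP[y1 y2] /andP[x1 x2]; apply/andP; split; lra.
  by move=> /andP[y1 y2] /andP[x1 x2]; apply/andP; split; lra.
have Pvol : leb P = ((eps * a) ^+ n)%:E.
  by apply: lebesgue_rV_box_cst => [|i]; [exact: ltW|rewrite !mxE; ring].
have -> : c * eps ^+ n * h * b `^ p = c / a ^+ n * h * b `^ p * (eps * a) ^+ n.
  by rewrite exprMn; field; rewrite expf_neq0// gt_eqF.
apply: (@source_ge _ _ _ _ _ _ th n0 g0 p0 x t s _ K b _ P) => //.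
- by rewrite -subr_gt0.
- exact: measurable_box.
- by rewrite divr_ge0 ?exprn_ge0 ?(ltW c0) ?(ltW a0).
- move=> y Py; rewrite -ath Gc// => i; rewrite !mxE (le_trans (Px y i Py))//.
  rewrite ler_wpM2r ?(ltW a0)// (le_trans _ eps_kappa)//.
  rewrite -[leLHS]mulr1 ler_pM ?(ltW eps0)//.
  by rewrite ler_peMl ?(ltW eps0)// ler1n.
- by move=> y /PQ /yK.
- by apply: filterS bu => y bu /PQ /bu.
Qed.

(* Above the threshold, Duhamel's formula restarted at the times s_k below, which
   increase to 3 tau / 2, multiplies the lower bound by lam at every step. *)
Lemma no_blowup_bound (w : rV) (A b : R) : 0 < b -> 0 < A -> 2 * A `^ theta <= T ->
  (forall y, cube w (eps * A) y -> enorm y <= K) ->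
  lowerb (b / A ^+ n) (cube w (eps * A)) (A `^ theta) (2 * A `^ theta) ->
  c * eps ^+ n * h * b `^ (theta / n%:R) <= 4 * 2 `^ (n%:R / theta).
Proof.
move=> b0 A0 AT yK low0; rewrite leNgt; apply/negP => big.
set q := theta / n%:R in big.
have q0 : 0 < q by rewrite divr_gt0.
(* Chosen so that lam^q = 2: the factor lam^(q k) = 2^k in the gain offsets the length of the k-th
   time step, proportional to 2^(-k). *)
pose lam : R := 2 `^ (n%:R / theta).
have lam1 : 1 < lam.
  apply: (@le_lt_trans _ _ (1 `^ (n%:R / theta))); first by rewrite powR1.
  by rewrite /lam gt0_ltr_powR ?nnegrE ?divr_gt0// ltr1n.
have lam0 : 0 < lam by rewrite (lt_trans ltr01).
have lamq : lam `^ q = 2.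
  rewrite -powRrM (_ : _ / _ * _ = 1) ?powRr1//.
  by rewrite /q; field; rewrite !gt_eqF.
set tau := A `^ theta in AT low0.
have tau0 : 0 < tau by rewrite powR_gt0.
have An0 : 0 < A ^+ n by rewrite exprn_gt0.
(* Here s_0 = tau and s_(k+1) - s_k = tau 2^(-k) / 4. The limit 3 tau / 2 leaves the interval (3 tau
   / 2, 2 tau), on which all bounds hold at once. *)
pose s (k : nat) : R := tau * (3 / 2 - 2 ^- k / 2).
have two0 k : 0 < (2 ^- k : R) by rewrite invr_gt0 exprn_gt0.
have two1 k : (2 ^- k : R) <= 1 by rewrite invf_le1 ?exprn_gt0// exprn_ege1// ler1n.
have twoS k : (2 ^- k.+1 : R) = 2 ^- k / 2 by rewrite exprS invfM mulrC.
have s1 k : tau <= s k by rewrite /s ler_peMr ?(ltW tau0)//; have := two1 k; lra.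
have s2 k : s k <= 3 / 2 * tau.
  by rewrite /s mulrC ler_wpM2r ?(ltW tau0)//; have := two0 k; lra.
have sS k : s k.+1 - s k = tau * 2 ^- k / 4 by rewrite /s twoS; field; rewrite expf_neq0.
have aeF := ae_filter_ringOfSetsType leb1.
have low k : lowerb (b * lam ^+ k / A ^+ n) (cube w (eps * A)) (s k) (2 * tau).
  elim: k => [|k ih].
    by rewrite expr0 mulr1 /s (_ : tau * _ = tau)//; field.
  pose bk := b * lam ^+ k / A ^+ n.
  have bk0 : 0 < bk by rewrite divr_gt0 ?mulr_gt0 ?exprn_gt0.
  have sk0 : s k <= s k.+1.
    by rewrite -subr_ge0 sS !mulr_ge0 ?invr_ge0 ?exprn_ge0 ?(ltW tau0).
  (* The empty set discards the initial measure; the only source block runs from [s k] to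
     [s k.+1]. *)
  have stepk := @lowerb_step (cube w (eps * A)) set0 (s k.+1) (2 * tau) 0 0 1
    (fun=> s k) (fun=> s k.+1) (fun=> bk) (fun=> c * eps ^+ n * h * bk `^ p)
    (fun=> cube w (eps * A)) (le_trans (ltW tau0) (s1 _)) AT measurable0 (lexx 0) _ _ _ _ _ _.
  apply: (lowerbW _ (stepk _ _ _ _ _ _)).
  - rewrite mul0r add0r big_ord1 sS.
    have -> : c * eps ^+ n * h * bk `^ p * (tau * 2 ^- k / 4) =
        (c * eps ^+ n * h * b `^ q / 4) * (b * lam ^+ k / A ^+ n).
      have -> : bk `^ p = b * lam ^+ k * (b `^ q * 2 ^+ k) / A ^+ n / tau.
        apply: (@mulIf _ (A ^+ n)); first by rewrite gt_eqF.
        rewrite powR_scaling// ?mulr_ge0 ?exprn_ge0 ?(ltW b0) ?(ltW lam0)//.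
        rewrite powRM ?exprn_ge0 ?(ltW b0) ?(ltW lam0)//.
        have pq : p = 1 + q by rewrite pE.
        have -> : b `^ p = b * b `^ q.
          by rewrite pq powRD ?powRr1 ?(ltW b0)// (gt_eqF b0) implybT.
        have lk0 : 0 < lam ^+ k by rewrite exprn_gt0.
        have -> : (lam ^+ k) `^ p = lam ^+ k * 2 ^+ k.
          rewrite pq powRD ?powRr1 ?(ltW lk0) ?(gt_eqF lk0) ?implybT//.
          congr (_ * _); rewrite -(powR_mulrn k (ltW lam0)) -powRrM mulrC powRrM lamq.
          by rewrite powR_mulrn.
        by rewrite -/tau; field; rewrite !gt_eqF.
      by field; rewrite !gt_eqF ?exprn_gt0.
    have -> : b * lam ^+ k.+1 / A ^+ n = lam * (b * lam ^+ k / A ^+ n).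
      by rewrite exprS; field; rewrite gt_eqF.
    (* The step multiplies the bound by c eps^n h b^q / 4, which exceeds lam precisely by [big]. *)
    rewrite ler_wpM2r ?(ltW bk0)// ler_pdivlMr// mulrC; exact: ltW.
  - by rewrite measure0.
  - by [].
  - move=> i _; split => //; first by rewrite (le_trans (ltW tau0)).
    by rewrite !mulr_ge0 ?powR_ge0 ?exprn_ge0 ?(ltW c0) ?(ltW eps0).
  - by move=> [|//] [|].
  - move=> i _; apply: (@filterS _ _ aeF) ih => t lowt /andP[t1 t2].
    apply: lowt; rewrite t1 (lt_le_trans t2)// (le_trans (s2 _))//.
    by rewrite ler_wpM2r ?(ltW tau0)//; lra.
  - move=> i x t s' _ Qx /andP[st t2] /andP[ss ss'] bu.
    apply: (source_ge_corner (ltW bk0) A0 _ Qx yK bu).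
    rewrite subr_gt0 (lt_trans ss' st)/= -/tau lerBlDr.
    by rewrite (le_trans (ltW t2))// mulr_natl mulr2n lerD2l (le_trans (s1 k))// ltW.
have all_low : {ae leb1, forall t, 3 / 2 * tau < t < 2 * tau ->
    {ae leb, forall x, cube w (eps * A) x -> forall k, ((b * lam ^+ k / A ^+ n)%:E <= u x t)%E}}.
  have := ae_foralln low; apply: (@filterS _ _ aeF) => t lowt /andP[t1 t2].
  have : {ae leb, forall x k, cube w (eps * A) x -> ((b * lam ^+ k / A ^+ n)%:E <= u x t)%E}.
    apply: ae_foralln => k; apply: lowt.
    by rewrite t2 andbT (le_lt_trans (s2 k)).
  by apply: filterS => x ux Qx k; exact: ux.
(* At almost every time, [u] is finite at almost every x, yet here it would exceed b lam^k / A^n for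
   all k on a cube of positive volume. *)
have bad : {ae leb1, forall t, ~ (3 / 2 * tau < t < 2 * tau)}.
  have := @filterS2 _ _ aeF _ _ _ _ all_low solution_sections.
  apply => t lowt solt tt.
  have /andP[t1 t2] := tt.
  have tT : 0 < t < T.
    by rewrite (lt_le_trans t2 AT) (le_lt_trans _ t1)// mulr_ge0// ltW.
  have : {ae leb, forall x, ~ cube w (eps * A) x}.
    apply: filterS2 (lowt tt) solt => x ux solx Qx.
    have [u_fin _] := solx tT.
    have uk := ux Qx.
    have u0 : u x t \is a fin_num.
      rewrite ge0_fin_numE// (le_trans _ (uk 0%N))// lee_fin.
      by rewrite divr_ge0 ?mulr_ge0 ?exprn_ge0 ?(ltW b0) ?(ltW lam0) ?(ltW A0).
    pose v := fine (u x t); have vE : u x t = v%:E by rewrite fineK.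
    have v0 : 0 < v.
      rewrite -lte_fin -vE (lt_le_trans _ (uk 0%N))// lte_fin expr0 mulr1.
      by rewrite divr_gt0.
    have D0 : 0 < b / A ^+ n / v by rewrite !divr_gt0.
    have : lam^-1 ^+ k @[k --> \oo] --> 0.
      by apply: cvg_expr; rewrite ger0_norm ?invr_ge0 ?(ltW lam0)// invf_lt1.
    move=> /cvgr0_norm_lt /(_ _ D0)[k _ /(_ k (leqnn k))] /=.
    rewrite ger0_norm ?exprn_ge0 ?invr_ge0 ?(ltW lam0)// exprVn => lamk.
    have := uk k; rewrite vE lee_fin leNgt => /negP; apply.
    rewrite mulrAC -ltr_pdivrMr ?exprn_gt0// mulrC -ltr_pdivlMr//.
  rewrite /almost_everywhere/= => Qneg.
  have : leb (cube w (eps * A)) = 0%E.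
    apply: measure_negligible; first exact: measurable_box.
    by rewrite -[cube _ _]setCK.
  rewrite lebesgue_rV_cube ?mulr_ge0 ?(ltW eps0) ?(ltW A0)// => -[] /eqP.
  by rewrite gt_eqF// exprn_gt0// !mulr_gt0.
have : leb1 `]3 / 2 * tau, 2 * tau[%classic = 0%E.
  apply: measure_negligible => //.
  apply: (negligibleS _ bad) => t /=; rewrite in_itv/= => tt.
  by move=> nt; exact: nt.
move=> /(etrans (esym (lebesgue_measure_itv _))); rewrite /= lte_fin.
have -> : 3 / 2 * tau < 2 * tau by rewrite ltr_pM2r//; lra.
move=> [] /eqP; rewrite gt_eqF//.
by rewrite -mulrBl mulr_gt0//; lra.
Qed.

(** * The chain of blocks *)

Local Notation r4 := (4 `^ theta^-1 : R).
Local Notation c1 := (c / r2 ^+ n).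

Let r41 : 1 <= r4.
Proof.
apply: (@le_trans _ _ (1 `^ theta^-1)); first by rewrite powR1.
by rewrite ge0_ler_powR ?nnegrE ?invr_ge0 ?ler1n ?(ltW th0).
Qed.
Let r40 : 0 < r4. Proof. exact: lt_le_trans r41. Qed.

(** The factors are the kernel bound at comparable times, the normalized volume of a cube, and the
    lower bound of |y|^(-gamma). *)
Definition gain : R := c1 * (2 * eps) ^+ n * h.

Fixpoint bseq (m : R) (j : nat) : R :=
  if j is i.+1 then bseq m i + gain * bseq m i `^ p else c1 * m.

Lemma c1_gt0 : 0 < c1. Proof. by rewrite divr_gt0// exprn_gt0. Qed.

Lemma gain_gt0 : 0 < gain.
Proof. by rewrite !mulr_gt0 ?c1_gt0 ?exprn_gt0 ?mulr_gt0. Qed.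

Lemma bseq_gt0 m j : 0 < m -> 0 < bseq m j.
Proof.
move=> m0; elim: j => [|j ih] /=; first by rewrite mulr_gt0 ?c1_gt0.
by rewrite ltr_wpDr// mulr_ge0 ?powR_ge0 ?(ltW gain_gt0).
Qed.

(** The unrolled form is what Duhamel's formula produces: the initial mass plus all earlier
    blocks. *)
Lemma bseqE m j : bseq m j = c1 * m + \sum_(i < j) gain * bseq m i `^ p.
Proof.
elim: j => [|j ih]; first by rewrite big_ord0 addr0.
by rewrite big_ord_recr addrA -ih.
Qed.

(** Times grow by the factor 4: for t in (tau_j, 2 tau_j) and s in an earlier block, t - s lies
    between tau_j / 2 and 2 tau_j, as [heat_kernel_ge_comparable] requires. *)
Definition scale (A : R) (j : nat) : R := A * r4 ^+ j.

Lemma scale_gt0 A j : 0 < A -> 0 < scale A j.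
Proof. by move=> A0; rewrite mulr_gt0// exprn_gt0. Qed.

Lemma le_scale A i j : 0 < A -> (i <= j)%N -> scale A i <= scale A j.
Proof. by move=> A0 ij; rewrite ler_wpM2l ?(ltW A0)// ler_weXn2l. Qed.

Lemma scaleX A j : 0 < A -> scale A j `^ theta = 4 ^+ j * A `^ theta.
Proof.
move=> A0; rewrite /scale powRM ?exprn_ge0 ?(ltW A0) ?(ltW r40)// mulrC.
congr (_ * _); rewrite -powR_mulrn ?(ltW r40)// -powRrM mulrC powRrM.
by rewrite powR_thK// powR_mulrn.
Qed.

Lemma sub_cube (w y : rV) r r' : r <= r' -> cube w r y -> cube w r' y.
Proof. by move=> rr' /cubeP yr; apply/cubeP => i; exact: le_trans rr'. Qed.

(** All blocks i < j feed block j, hence the strong induction. By [powR_scaling] the scale of block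
    i drops out, and the sum left is that of [bseqE]. *)
Lemma lowerb_bseq (w : rV) (A m : R) (J : nat) : 0 < A -> 0 < m ->
  (m%:E <= mu (cube w (eps * A)))%E -> 2 * scale A J `^ theta <= T ->
  (forall y, cube w (eps * scale A J) y -> enorm y <= K) ->
  forall j, (j <= J)%N -> lowerb (bseq m j / scale A j ^+ n)
    (cube w (eps * scale A j)) (scale A j `^ theta) (2 * scale A j `^ theta).
Proof.
move=> A0 m0 mmu AT yK j; have [k jk] := ubnP j; elim: k j jk => // k ih j jk jJ.
have At0 : 0 < A `^ theta by rewrite powR_gt0.
have Aj0 := scale_gt0 j A0.
have Ajn0 : 0 < scale A j ^+ n by rewrite exprn_gt0.
have sth0 i : 0 < scale A i `^ theta by rewrite powR_gt0// scale_gt0.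
have s4 i i' : (i < i')%N -> 4 * scale A i `^ theta <= scale A i' `^ theta.
  by move=> ii; rewrite !scaleX// mulrA -exprS ler_wpM2r ?(ltW At0)// ler_weXn2l// ler1n.
have cubej i y : (i <= j)%N -> cube w (eps * scale A i) y -> cube w (eps * scale A j) y.
  by move=> ij; apply: sub_cube; rewrite ler_wpM2l ?(ltW eps0)// le_scale.
have dist x y i : (i <= j)%N -> cube w (eps * scale A j) x -> cube w (eps * scale A i) y ->
    forall l, `|(x - y) 0 l| <= 2 * eps * scale A j.
  move=> ij /cubeP Qx /(cubej _ _ ij)/cubeP Qy l; rewrite !mxE.
  have -> : x 0 l - y 0 l = (x 0 l - w 0 l) - (y 0 l - w 0 l) by ring.
  by rewrite (le_trans (ler_normB _ _))// -mulrA mulr_natl mulr2n lerD.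
pose ww i := c1 / scale A j ^+ n * h * (bseq m i / scale A i ^+ n) `^ p *
  (2 * (eps * scale A i)) ^+ n.
have step := @lowerb_step (cube w (eps * scale A j)) (cube w (eps * A))
  (scale A j `^ theta) (2 * scale A j `^ theta) (c1 / scale A j ^+ n) m j
  (fun i => scale A i `^ theta) (fun i => 2 * scale A i `^ theta)
  (fun i => bseq m i / scale A i ^+ n) ww (fun i => cube w (eps * scale A i))
  (ltW (sth0 j)) _ (measurable_box _ _) _ mmu.
apply: (lowerbW _ (step _ _ _ _ _ _ _)).
- rewrite bseqE mulrDl mulrAC lerD2l mulr_suml; apply: ler_sum => i _.
  have -> : 2 * scale A i `^ theta - scale A i `^ theta = scale A i `^ theta by ring.
  have -> : ww i = c1 / scale A j ^+ n * h * (2 * eps) ^+ n *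
      (bseq m i `^ p / scale A i `^ theta).
    rewrite -powR_scaling ?(ltW (bseq_gt0 _ m0)) ?scale_gt0//.
    by rewrite /ww mulrA [(_ * scale A i) ^+ n]exprMn; ring.
  rewrite le_eqVlt; apply/orP; left; apply/eqP.
  by rewrite /gain; field; rewrite !gt_eqF// exprn_gt0.
- by rewrite (le_trans _ AT)// ler_wpM2l// ler_powR_th ?(ltW (scale_gt0 _ A0))// le_scale.
- by rewrite divr_ge0 ?(ltW c1_gt0) ?(ltW Ajn0).
- move=> x t y Qx /andP[t1 t2] Ay; apply: heat_kernel_ge_comparable => //.
    rewrite (ltW t2) andbT (le_trans _ (ltW t1))//.
    by rewrite ler_pdivrMr// ler_peMr ?(ltW (sth0 j))// ler1n.
  apply: (dist x y 0%N) => //; by rewrite /scale expr0 mulr1.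
- move=> i ij; split.
  + exact: ltW.
  + by rewrite ler_peMl ?(ltW (sth0 i))// ler1n.
  + by rewrite (le_trans _ (s4 _ _ ij))// ler_wpM2r ?(ltW (sth0 i))// ler_nat.
  + have cj : 0 <= c1 / scale A j ^+ n by rewrite divr_ge0 ?(ltW c1_gt0) ?(ltW Ajn0).
    have si0 : 0 <= 2 * (eps * scale A i).
      by rewrite mulr_ge0// mulr_ge0 ?(ltW eps0) ?(ltW (scale_gt0 _ A0)).
    have hi0 := mulr_ge0 (mulr_ge0 cj (ltW h0)) (powR_ge0 (bseq m i / scale A i ^+ n) p).
    exact: mulr_ge0 hi0 (exprn_ge0 _ si0).
- move=> i i' s _ _ /andP[s1 s2] /andP[s3 s5].
  case: (ltngtP i i') => // ii; exfalso.
    have := lt_trans s3 s2; have := s4 _ _ ii; have := sth0 i; lra.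
  have := lt_trans s1 s5; have := s4 _ _ ii; have := sth0 i'; lra.
- by move=> i ij; apply: ih; rewrite ?(leq_trans ij)// ltnW// (leq_trans ij).
- move=> i x t s ij Qx /andP[t1 t2] /andP[s1 s2] bu.
  have s4' := s4 _ _ ij; have si := sth0 i.
  apply: (@source_ge _ _ _ _ _ _ th n0 g0 p0 x t s _ K _ _ (cube w (eps * scale A i))) => //.
  + by lra.
  + exact: measurable_box.
  + by apply: lebesgue_rV_cube; rewrite mulr_ge0 ?(ltW eps0) ?(ltW (scale_gt0 _ A0)).
  + by rewrite divr_ge0 ?(ltW c1_gt0) ?(ltW Ajn0).
  + by rewrite divr_ge0 ?(ltW (bseq_gt0 _ m0)) ?exprn_ge0 ?(ltW (scale_gt0 _ A0)).
  + move=> y Qy; apply: heat_kernel_ge_comparable => //; last exact: dist (ltnW ij) Qx Qy.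
    by apply/andP; split; lra.
  + move=> y Qy; apply: yK; apply: sub_cube (cubej _ _ (ltnW ij) Qy).
    by rewrite ler_wpM2l ?(ltW eps0)// le_scale.
Qed.
(** [no_blowup_bound] is applied at scale j; its coefficient and [gain] differ by the factor (2 /
    r2)^n, which is at most 2^n. *)
Lemma bseq_bounded (w : rV) (A m : R) (J : nat) : 0 < A -> 0 < m ->
  (m%:E <= mu (cube w (eps * A)))%E -> 2 * scale A J `^ theta <= T ->
  (forall y, cube w (eps * scale A J) y -> enorm y <= K) ->
  forall j, (j <= J)%N ->
    gain * bseq m j `^ (theta / n%:R) <= 2 ^+ n * (4 * 2 `^ (n%:R / theta)).
Proof.
move=> A0 m0 mmu AT yK j jJ.
have low := lowerb_bseq A0 m0 mmu AT yK jJ.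
have jJs := le_scale A0 jJ.
have sj0 := scale_gt0 j A0.
have := no_blowup_bound (bseq_gt0 j m0) sj0 _ _ low.
set q := theta / n%:R; move=> bnd.
have {}bnd : c * eps ^+ n * h * bseq m j `^ q <= 4 * 2 `^ (n%:R / theta).
  apply: bnd => [|y Qy].
    rewrite (le_trans _ AT)// ler_wpM2l// ler_powR_th// ltW// scale_gt0//.
  by apply: yK; apply: sub_cube Qy; rewrite ler_wpM2l// ltW.
have -> : gain * bseq m j `^ q = 2 ^+ n * (c * eps ^+ n * h * bseq m j `^ q / r2 ^+ n).
  by rewrite /gain exprMn; field; rewrite expf_neq0// gt_eqF.
rewrite ler_wpM2l ?exprn_ge0// ler_pdivrMr ?exprn_gt0//.
by rewrite (le_trans bnd)// ler_peMr ?exprn_ege1.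
Qed.

End iteration.

(** J is the integer part of log_4 (ell^theta), so that 4^J <= ell^theta; the loss from rounding
    down is made up by [J.+1]. *)
Lemma exists_dyadic_scale (R : realType) (theta A T ell : R) : 0 < theta -> 0 < A ->
  1 <= ell -> 2 * (A `^ theta * ell `^ theta) <= T ->
  exists J : nat, 2 * (4 ^+ J * A `^ theta) <= T /\ theta / ln 4 * ln ell <= J.+1%:R.
Proof.
move=> th0 A0 ell1 AT.
have l4 : 0 < ln 4 :> R by rewrite ln_gt0// ltr1n.
have ell0 : 0 < ell by rewrite (lt_le_trans ltr01).
pose x := theta / ln 4 * ln ell.
have x0 : 0 <= x := mulr_ge0 (divr_ge0 (ltW th0) (ltW l4)) (ln_ge0 ell1).
exists (Num.truncn x); have /andP[Jx xJ] := truncn_itv x0; split; last exact: ltW.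
apply: le_trans AT; rewrite ler_wpM2l// mulrC ler_wpM2l ?powR_ge0//.
rewrite -powR_mulrn// /powR !gt_eqF// ler_expR.
apply: (@le_trans _ _ (x * ln 4)); first by rewrite ler_wpM2r// ltW.
by rewrite /x mulrAC divfK// gt_eqF.
Qed.

Lemma measurable_enorm (R : realType) (n : nat) :
  measurable_fun setT (@enorm R n).
Proof.
apply: (measurable_comp (F := setT) (E := setT) (f := @Num.sqrt R)) => //.
  exact: continuous_measurable_fun (@sqrt_continuous R).
apply: measurable_sum => i; apply: measurable_funX.
exact: measurable_coord_rV.
Qed.

Lemma measurable_eball (R : realType) (n : nat) (z : 'rV[R]_n) (r : R) :
  measurable (eball z r).
Proof.
have mz : measurable_fun setT (fun y : 'rV[R]_n => enorm (z - y)).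
  apply: (measurable_comp _ _ (@measurable_enorm R n)) => //.
  apply: measurable_fun_rV => i.
  under eq_fun do rewrite !mxE.
  by apply: measurable_funB => //; exact: measurable_coord_rV.
have := mz measurableT `]-oo, r[%classic (measurable_itv _).
rewrite setTI; congr measurable; apply/seteqP; split => y /=; by rewrite in_itv.
Qed.

(** * Covering a ball by small cubes *)

Section covering.
Context {R : realType} {n : nat}.
Implicit Types (z v : 'rV[R]_n).

Lemma le_measure_bigsetU_seq d (S : measurableType d) (mu : {measure set S -> \bar R})
    (I : Type) (s : seq I) (A : I -> set S) (B : \bar R) :
  (forall i, measurable (A i)) -> (forall i, (mu (A i) <= B)%E) -> (0 <= B)%E ->
  (mu (\big[setU/set0]_(i <- s) A i) <= (size s)%:R%:E * B)%E.
Proof.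
move=> mA AB B0; elim: s => [|i s ih]; first by rewrite big_nil measure0 mul0e.
rewrite big_cons (le_trans (measureU2 _ _ _))//; first exact: bigsetU_measurable.
rewrite -natr1 EFinD ge0_muleDl ?lee_fin// mul1e addeC.
exact: leeD ih (AB i).
Qed.

(* A cube of radius sigma is cut into M^n subcubes of radius sigma / M. *)
Definition subcenter (M : nat) z (sigma : R) (f : {ffun 'I_n -> 'I_M.+1}) : 'rV[R]_n :=
  \row_i (z 0 i - sigma + (2 * (f i)%:R + 1) * sigma / M.+1%:R).

Lemma eball_cover (M : nat) z sigma : 0 < sigma ->
  eball z sigma `<=` \big[setU/set0]_(f : {ffun 'I_n -> 'I_M.+1})
    cube (subcenter z sigma f) (sigma / M.+1%:R).
Proof.
move=> s0 v zv; rewrite -bigcup_seq.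
have M0 : 0 < M.+1%:R :> R by [].
have vz i : `|v 0 i - z 0 i| < sigma.
  rewrite distrC; apply: le_lt_trans zv; have := ler_coord_enorm (z - v) i.
  by rewrite !mxE.
(* The position of v_i above the lower face in units of the side 2 sigma / (M + 1); its integer part
   is the index of the subcube. *)
pose x i := (v 0 i - z 0 i + sigma) * M.+1%:R / (2 * sigma).
have x0 i : 0 <= x i.
  have := vz i; rewrite ltr_norml => /andP[h _].
  by rewrite divr_ge0 ?mulr_ge0 ?(ltW s0)//; move: h; lra.
have xM i : x i < M.+1%:R.
  have := vz i; rewrite ltr_norml => /andP[_ h].
  rewrite /x mulrAC gtr_pMl// ltr_pdivrMr ?mulr_gt0// mul1r; move: h; lra.
have tM i : (Num.truncn (x i) < M.+1)%N by rewrite truncn_lt_nat.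
exists [ffun i => Ordinal (tM i)] => /=; first by rewrite mem_index_enum.
apply/cubeP => i; rewrite !mxE ffunE/=.
have /andP[t1 t2] := truncn_itv (x0 i); set k := (Num.truncn (x i))%:R in t1 t2 *.
rewrite -natr1 -/k in t2.
have -> : v 0 i - (z 0 i - sigma + (2 * k + 1) * sigma / M.+1%:R) =
    (2 * (x i - k) - 1) * (sigma / M.+1%:R).
  by rewrite /x; field; rewrite !gt_eqF.
rewrite normrM (gtr0_norm (divr_gt0 s0 M0)) ler_piMl ?divr_ge0 ?(ltW s0)//.
by rewrite ler_norml; apply/andP; split; lra.
Qed.

Lemma subcenter_near (M : nat) z sigma f i : 0 < sigma ->
  `|@subcenter M z sigma f 0 i| <= `|z 0 i| + sigma.
Proof.
move=> s0; rewrite !mxE -addrA (le_trans (ler_normD _ _))// lerD2l.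
have M0 : 0 < M.+1%:R :> R by [].
have f1 : (f i)%:R + 1 <= M.+1%:R :> R by rewrite natr1 ler_nat.
have f0 : 0 <= (f i)%:R :> R by [].
rewrite ler_norml; apply/andP; split.
  by rewrite lerDl divr_ge0 ?mulr_ge0 ?addr_ge0 ?mulr_ge0 ?(ltW s0).
suff : (2 * (f i)%:R + 1) * sigma / M.+1%:R <= 2 * sigma.
  by move=> h; rewrite addrC lerBlDr (_ : sigma + sigma = 2 * sigma)//; ring.
rewrite ler_pdivrMr// [leRHS]mulrAC ler_wpM2r ?(ltW s0)//.
by move: f1; lra.
Qed.

End covering.

(** * Choice of constants and conclusion *)

Lemma le_of_real_minorants (R : realType) (x : \bar R) (B : R) : 0 <= B ->
  (forall m : R, 0 < m -> (m%:E <= x)%E -> m <= B) -> (x <= B%:E)%E.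
Proof.
move=> B0 xB; rewrite leNgt; apply/negP; case: x xB => [r| |] xB.
- rewrite lte_fin => Br; have := xB r (le_lt_trans B0 Br) (lexx _).
  by rewrite leNgt Br.
- by move=> _; have := xB (B + 1); rewrite ltr_wpDl// leey leNgt ltrDl ltr01 => /(_ isT isT).
- by [].
Qed.

(** [D] stands for |z|; the bound 2 D on the coordinates of [w] admits the centres of all subcubes
    of the ball. *)
Theorem small_cube_mass_bound (R : realType) (n : nat) (theta gamma p : R) :
  (0 < n)%N -> 0 < theta <= 2 -> p = 1 + theta / n%:R -> 0 < gamma ->
  exists (M : nat) (C : R), 0 < C /\
    forall (T D sigma : R) (mu : {measure set 'rV[R]_n -> \bar R})
      (u : 'rV[R]_n -> R -> \bar R) (w : 'rV[R]_n),
      0 < T -> is_solution theta gamma p mu u T%:E -> T `^ theta^-1 < D ->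
      (forall i, `|w 0 i| <= 2 * D) -> 0 < sigma < T `^ theta^-1 ->
      (mu (cube w (sigma / M.+1%:R)) <=
        (C * D `^ (gamma / (theta / n%:R)) *
         ln (expR 1 + T `^ theta^-1 / sigma) `^ (- (n%:R / theta)))%:E)%E.
Proof.
move=> n0 th pE g0; have /andP[th0 th2] := th.
have nR0 : 0 < n%:R :> R by rewrite ltr0n.
pose q := theta / n%:R; have q0 : 0 < q by rewrite divr_gt0.
have qV : q^-1 = n%:R / theta by rewrite /q invf_div.
have powRp (x : R) : 0 < x -> x `^ p = x * x `^ q.
  by move=> x0; rewrite pE powRD ?powRr1 ?(ltW x0)// (gt_eqF x0) implybT.
have [c [kappa [c0 kappa0 Gc]]] := @heat_kernel_ge R n theta th.
pose r2 : R := 2 `^ theta^-1; have r20 : 0 < r2 by rewrite powR_gt0.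
pose eps := kappa / (2 * r2); have eps0 : 0 < eps by rewrite divr_gt0 ?mulr_gt0.
have eps_kappa : 2 * eps * r2 <= kappa.
  by rewrite /eps le_eqVlt; apply/orP; left; apply/eqP; field; rewrite gt_eqF.
pose Z : R := 2 ^+ n * (4 * 2 `^ (n%:R / theta)).
have Z0 : 0 < Z by rewrite !mulr_gt0 ?exprn_gt0 ?powR_gt0.
have [E E0 HE] := recursion_bound q0 Z0.
pose c1 := c / r2 ^+ n; have c10 : 0 < c1 by rewrite divr_gt0 ?exprn_gt0.
pose kk := n%:R * (2 + eps); have kk0 : 0 < kk by rewrite mulr_gt0 ?addr_gt0.
(* The part of gain (c1 m)^q that is free of D and m; the other factors are D^(-gamma) and m^q. *)
pose G0 := c1 * (2 * eps) ^+ n * kk `^ (- gamma) * c1 `^ q.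
have e20 : 0 < 2 * eps by rewrite mulr_gt0.
have G00 : 0 < G0.
  exact: mulr_gt0 (mulr_gt0 (mulr_gt0 c10 (exprn_gt0 n e20)) (powR_gt0 _ kk0)) (powR_gt0 _ c10).
have l4 : 0 < ln 4 :> R by rewrite ln_gt0// ltr1n.
pose k0 := theta / ln 4; have k00 : 0 < k0 by rewrite divr_gt0.
have EG0 : 0 < E / (G0 * k0) := divr_gt0 E0 (mulr_gt0 G00 k00).
(* Subcubes are so small that A = sigma / ((M + 1) eps) satisfies 2^(1/theta) A ell <= T^(1/theta),
   in view of ell = e + L <= (e + 1) L for L > 1. *)
pose M := Num.truncn (r2 * (expR 1 + 1) / eps).
have M0 : 0 < M.+1%:R :> R by [].
have Meps : r2 * (expR 1 + 1) <= M.+1%:R * eps.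
  by rewrite -ler_pdivrMr// ltW// truncnS_gt.
exists M, ((E / (G0 * k0)) `^ (n%:R / theta)); split.
  exact: powR_gt0.
move=> T D sigma mu u w T0 sol TD wD /andP[s0 sT].
pose a := T `^ theta^-1; have a0 : 0 < a by rewrite powR_gt0.
have aT : a `^ theta = T by rewrite -powRrM mulVf ?gt_eqF// powRr1// ltW.
have D0 : 0 < D := lt_trans a0 TD.
pose L := a / sigma; have L1 : 1 < L by rewrite ltr_pdivlMr// mul1r.
(* With the argument of the logarithm as the ratio of scales, the bound contains ln ell directly,
   and sigma close to T^(1/theta) needs no separate case. *)
pose ell := expR 1 + L.
have e10 : 0 < expR 1 :> R := expR_gt0 _.
have ell1 : 1 < ell by rewrite /ell; move: e10 L1; lra.
have ell0 : 0 < ell := lt_trans ltr01 ell1.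
have lnell : 0 < ln ell by rewrite ln_gt0.
(* The recursion starts from a real number, so it is run on any real m > 0 below the mass of the
   cube. *)
apply: le_of_real_minorants => [|m m0 mmu]; first by rewrite !mulr_ge0 ?powR_ge0.
pose A := sigma / M.+1%:R / eps; have A0 : 0 < A := divr_gt0 (divr_gt0 s0 M0) eps0.
have eA : eps * A = sigma / M.+1%:R by rewrite /A mulrC divfK// gt_eqF.
have Aell : r2 * (A * ell) <= a.
  have -> : a = L * sigma by rewrite /L divfK// gt_eqF.
  have -> : r2 * (A * ell) = sigma * (r2 * ell) / (M.+1%:R * eps).
    by rewrite /A; field; rewrite !gt_eqF.
  rewrite (ler_pdivrMr _ _ (mulr_gt0 M0 eps0)) [L * sigma]mulrC -[leRHS]mulrA.
  rewrite ler_wpM2l ?(ltW s0)//.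
  apply: le_trans (ler_wpM2l (ltW (lt_trans ltr01 L1)) Meps).
  rewrite mulrCA ler_wpM2l ?(ltW r20)// /ell mulrDr mulr1 lerD2r.
  by rewrite ler_peMl ?ltW.
have r2th : r2 `^ theta = 2 by rewrite -powRrM mulVf ?gt_eqF// powRr1.
have [|J [JT Jell]] := @exists_dyadic_scale R theta A T ell th0 A0 (ltW ell1).
  have Al0 : 0 <= A * ell := mulr_ge0 (ltW A0) (ltW ell0).
  rewrite -(powRM _ (ltW A0) (ltW ell0)) -[2]r2th -(powRM _ (ltW r20) Al0) -[T]aT.
  rewrite ge0_ler_powR ?nnegrE ?(ltW th0) ?(ltW a0)//.
  exact: mulr_ge0 (ltW r20) Al0.
rewrite -(scaleX th J A0) in JT.
have sJ0 : 0 < scale theta A J := scale_gt0 theta J A0.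
(* Since T < D^theta, even the largest cube has radius at most eps D, which gives |y| <= n (2 + eps)
   D on it. *)
have sJD : scale theta A J <= D.
  rewrite leNgt; apply/negP => Ds; move: JT; rewrite leNgt => /negP; apply.
  have Dth : 0 < D `^ theta by rewrite powR_gt0.
  have TDth : T < D `^ theta by rewrite -aT gt0_ltr_powR ?nnegrE ?(ltW a0) ?(ltW D0).
  have DsJ : D `^ theta < scale theta A J `^ theta.
    by rewrite gt0_ltr_powR ?nnegrE ?(ltW sJ0) ?(ltW D0).
  rewrite (lt_trans TDth)// (lt_le_trans DsJ)// ler_peMl ?ler1n//.
  exact: powR_ge0.
pose K := kk * D; have K0 : 0 < K by rewrite mulr_gt0.
have yK y : cube w (eps * scale theta A J) y -> enorm y <= K.
  move=> /cubeP Qy; rewrite /K /kk -mulrA; apply: enorm_le_coord => [|i].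
    by rewrite mulr_ge0 ?addr_ge0 ?(ltW eps0) ?(ltW D0).
  have -> : y 0 i = (y 0 i - w 0 i) + w 0 i by ring.
  rewrite (le_trans (ler_normD _ _))// addrC mulrDl lerD//.
  by rewrite (le_trans (Qy i))// ler_wpM2l// ltW.
rewrite -eA in mmu.
have bnd := bseq_bounded th n0 g0 pE sol c0 Gc eps0 eps_kappa K0 A0 m0 mmu JT yK.
have b0 := fun j => bseq_gt0 (n := n) theta gamma p c0 eps0 K0 j m0.
have gain0 : 0 < @gain R n theta gamma c eps K := gain_gt0 theta gamma c0 eps0 K0.
have HJ : @gain R n theta gamma c eps K * (c1 * m) `^ q * J.+1%:R <= E.
  apply: (HE _ _ J gain0 b0 _ bnd) => j.
  rewrite /= mulrDr mulr1; congr (_ + _); rewrite mulrCA; congr (_ * _).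
  exact: powRp.
have {}HJ : G0 * D `^ (- gamma) * m `^ q * (k0 * ln ell) <= E.
  apply: le_trans HJ.
  have -> : @gain R n theta gamma c eps K * (c1 * m) `^ q = G0 * D `^ (- gamma) * m `^ q.
    rewrite /gain -/c1 /K (powRM _ (ltW kk0) (ltW D0)) (powRM _ (ltW c10) (ltW m0)).
    by rewrite /G0; ring.
  apply: ler_wpM2l Jell.
  exact: mulr_ge0 (mulr_ge0 (ltW G00) (powR_ge0 _ _)) (powR_ge0 _ _).
have mq : m `^ q <= E / (G0 * k0) * D `^ gamma * (ln ell)^-1.
  have -> : E / (G0 * k0) * D `^ gamma * (ln ell)^-1 =
      E / (G0 * D `^ (- gamma) * (k0 * ln ell)).
    have Dg0 : 0 < D `^ gamma by rewrite powR_gt0.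
    by rewrite powRN; field; rewrite (gt_eqF Dg0) (gt_eqF lnell) (gt_eqF k00) (gt_eqF G00).
  have den0 : 0 < G0 * D `^ (- gamma) * (k0 * ln ell).
    exact: mulr_gt0 (mulr_gt0 G00 (powR_gt0 _ D0)) (mulr_gt0 k00 lnell).
  by rewrite (ler_pdivlMr _ _ den0) mulrCA mulrA.
have -> : m = (m `^ q) `^ (n%:R / theta).
  by rewrite -qV -powRrM divff ?gt_eqF// powRr1// ltW.
have El0 : 0 <= E / (G0 * k0) * D `^ gamma.
  by rewrite mulr_ge0 ?powR_ge0 ?(ltW EG0).
apply: (@le_trans _ _ ((E / (G0 * k0) * D `^ gamma * (ln ell)^-1) `^ (n%:R / theta))).
  rewrite ge0_ler_powR ?nnegrE ?powR_ge0 ?divr_ge0 ?(ltW th0)//.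
  exact: ltW lnell.
rewrite powRM ?invr_ge0 ?(ltW lnell)// powRM ?powR_ge0 ?(ltW EG0)//.
rewrite -[(D `^ gamma) `^ _]powRrM -[gamma * _]/(gamma * (n%:R / theta)) -qV.
by rewrite -(powR_inv1 (ltW lnell)) -(powRrM (ln ell)) mulN1r.
Qed.
Theorem theorem1p2 (R : realType) (N : nat) (theta gamma p : R)
    (hN : (1 <= N)%N)
    (htheta : 0 < theta <= 2)
    (hp : p = 1 + theta / N%:R)
    (hgamma : 0 < gamma < Num.min theta N%:R)
    (hgamma_frac : theta < 2 -> gamma < theta * (p - 1)) :
  exists C2 : R, 0 < C2 /\
    forall (T : R) (mu : {measure set 'rV[R]_N -> \bar R})
           (u : 'rV[R]_N -> R -> \bar R) (z : 'rV[R]_N),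
      0 < T -> radon mu -> is_solution theta gamma p mu u T%:E ->
      T `^ theta^-1 < enorm z ->
      forall sigma : R, 0 < sigma -> sigma < T `^ theta^-1 ->
        (mu (eball z sigma) <=
          (C2 * enorm z `^ (gamma / (p - 1)) *
           ln (expR 1 + T `^ theta^-1 / sigma) `^ (- (N%:R / theta)))%:E)%E.
Proof.
have [M [C [C0 HC]]] := small_cube_mass_bound hN htheta hp (andP hgamma).1.
have qE : p - 1 = theta / N%:R by rewrite hp addrC addKr.
have Mn0 : 0 < (#|{: {ffun 'I_N -> 'I_M.+1}}|%:R : R).
  by rewrite card_ffun !card_ord ltr0n expn_gt0.
exists (#|{: {ffun 'I_N -> 'I_M.+1}}|%:R * C); split; first exact: mulr_gt0.
move=> T mu u z T0 _ sol Tz sigma s0 sT.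
set B := (C * enorm z `^ (gamma / (p - 1)) *
  ln (expR 1 + T `^ theta^-1 / sigma) `^ (- (N%:R / theta)))%R.
have cubeB (f : {ffun 'I_N -> 'I_M.+1}) :
    (mu (cube (subcenter z sigma f) (sigma / M.+1%:R)) <= B%:E)%E.
  rewrite /B qE; apply: (HC T (enorm z) sigma mu u _ T0 sol Tz) => [i|]; last first.
    by rewrite s0.
  (* The centres satisfy |w_i| <= |z| + sigma <= 2 |z|, because sigma < T^(1/theta) < |z|. *)
  rewrite (le_trans (subcenter_near z f i s0))// mulr_natl mulr2n lerD ?ler_coord_enorm//.
  by rewrite ltW// (lt_trans sT).
have B0 : 0 <= B by rewrite !mulr_ge0 ?powR_ge0 ?(ltW C0).
have mcubes f : measurable (cube (subcenter (M := M) z sigma f) (sigma / M.+1%:R)).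
  exact: measurable_box.
apply: le_trans (le_measure _ _ _ (eball_cover M (z := z) s0)) _.
- by rewrite inE; exact: measurable_eball.
- by rewrite inE; exact: bigsetU_measurable.
have B0' : (0 <= B%:E)%E by rewrite lee_fin.
have bU := le_measure_bigsetU_seq (index_enum {ffun 'I_N -> 'I_M.+1}) mcubes cubeB B0'.
apply: (le_trans bU).
rewrite -EFinM lee_fin /B !mulrA.
by rewrite -[index_enum _]enumT -cardE.
Qed.
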